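(* Let $d \ge 2$ be an integer, $0< s \le 1$, $1<\gamma<+\infty$, $1\le p, q < + \infty$, $1 <\alpha<d$, and $0< \beta_1, \beta_2 < + \infty$ be such that $$\beta_1p+2\beta_2q =1 \quad\text{and}\quad (d-sp)\beta_1+(d+\alpha)\beta_2 = \frac{d}{\gamma},$$ and $p(d+\alpha)-2q(d-sp)\neq 0$. Assume that either $$\beta_1 \gamma + \frac{d+\alpha-2}{d-1}\, \beta_2 \gamma < 1,$$ or $$\beta_1 \gamma + \frac{d+\alpha-2}{d-1}\, \beta_2 \gamma = 1 \ \text{ and }\ q(1-sp)\neq p .$$ Then there is no constant $C>0$ such that the inequality $$\| g\|_{L^\gamma(\mathbb{R}^d)} \leq C\, \| g\|_{\dot W^{s, p}(\mathbb{R}^d)}^{\beta_1 p} \left(\int_{\mathbb{R}^d}\int_{\mathbb{R}^d} \frac{|g(x)|^q|g(y)|^q}{|x-y|^{d-\alpha}}\,dx\,dy\right)^{\beta_2}$$ holds for all $g \in C^1_{c,\mathrm{rad}}(\mathbb{R}^d)$.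
   Context: $C^1_{c,\mathrm{rad}}(\mathbb{R}^d)$ denotes the space of all radial, continuously differentiable, compactly supported functions on $\mathbb{R}^d$. The notation $\|g\|_{\dot W^{s,p}(\mathbb{R}^d)}$ means $\left(\int_{\mathbb{R}^d}\int_{\mathbb{R}^d} \frac{|g(x)-g(y)|^p}{|x-y|^{d+sp}}\,dx\,dy\right)^{1/p}$ if $0<s<1$, and $\left(\int_{\mathbb{R}^d}|\nabla g(x)|^p\,dx\right)^{1/p}$ if $s=1$. *)

(* Defs.v *)
From HB Require Import structures.
From mathcomp Require Import all_boot all_order all_algebra.
From mathcomp Require Import all_classical all_reals all_analysis.
Set Implicit Arguments.
Unset Strict Implicit.
Unset Printing Implicit Defensive.
Import Order.TTheory GRing.Theory Num.Theory.
Import numFieldNormedType.Exports.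
Local Open Scope classical_set_scope.
Local Open Scope ring_scope.

Definition rV_display : measure_display.
Proof. exact: default_measure_display. Qed.

Section rV_measurable.
Context {R : realType} {n : nat}.

(* The sigma-algebra generated by the coordinates, as for [n.-tuple R]; it is
   the Borel one. *)
Definition rV_coord (i : 'I_n) (x : 'rV[R]_n) : measurableTypeR R := x 0 i.

Let rV_set0 : g_sigma_preimage rV_coord set0.
Proof. exact: sigma_algebra0. Qed.

Let rV_setC A : g_sigma_preimage rV_coord A -> g_sigma_preimage rV_coord (~` A).
Proof. exact: sigma_algebraC. Qed.

Let rV_bigcup (F : (set 'rV[R]_n)^nat) :
  (forall i, g_sigma_preimage rV_coord (F i)) ->
  g_sigma_preimage rV_coord (\bigcup_i (F i)).
Proof. exact: sigma_algebra_bigcup. Qed.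

HB.instance Definition _ := @isMeasurable.Build rV_display 'rV[R]_n
  (g_sigma_preimage rV_coord) rV_set0 rV_setC rV_bigcup.

Lemma measurable_rV_coord (i : 'I_n) :
  measurable_fun setT (rV_coord i : 'rV[R]_n -> measurableTypeR R).
Proof.
move=> _ Y mY; rewrite setTI; apply: sub_sigma_algebra.
by rewrite -bigcup_seq/=; exists i => /=; [rewrite mem_index_enum|exists Y; rewrite ?setTI].
Qed.

Lemma measurable_fun_rVP d (T : measurableType d) (f : T -> 'rV[R]_n) :
  measurable_fun setT f <->
  forall i, measurable_fun setT (rV_coord i \o f).
Proof.
split=> [mf i|mf].
  exact: (measurableT_comp (measurable_rV_coord i) mf).
have : preimage_set_system [set: T] f measurable `<=` measurable.
  rewrite -[X in preimage_set_system _ _ X]/(g_sigma_preimage (@rV_coord)).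
  rewrite -g_sigma_preimage_comp.
  apply: smallest_sub; first exact: sigma_algebra_measurable.
  move=> B; rewrite -bigcup_seq/= => -[i _ [Y mY <-]].
  exact: mf.
by move=> h _ A mA; apply: h; exists A.
Qed.

End rV_measurable.

Section lebesgue_rV.
Context {R : realType}.

Definition consrV n (z : measurableTypeR R * 'rV[R]_n) : 'rV[R]_n.+1 :=
  \row_i (if unlift ord0 i is Some j then z.2 0 j else z.1).

Definition unconsrV n (x : 'rV[R]_n.+1) : measurableTypeR R * 'rV[R]_n :=
  (x 0 ord0, \row_j x 0 (lift ord0 j)).

Lemma consrVK n : cancel (@consrV n) (@unconsrV n).
Proof.
move=> [a x]; congr pair; first by rewrite mxE unlift_none.
by apply/rowP => j; rewrite !mxE liftK.
Qed.

Lemma unconsrVK n : cancel (@unconsrV n) (@consrV n).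
Proof.
by move=> x; apply/rowP => i; rewrite mxE; case: unliftP => [j|] ->; rewrite ?mxE.
Qed.

Lemma measurable_consrV n : measurable_fun setT (@consrV n).
Proof.
apply/measurable_fun_rVP => i; rewrite /rV_coord /comp.
under eq_fun do rewrite mxE.
case: unliftP => [j _|_]; last exact: measurable_fst.
exact: (measurableT_comp (measurable_rV_coord j) measurable_snd).
Qed.

Lemma measurable_unconsrV n : measurable_fun setT (@unconsrV n).
Proof.
apply/measurable_fun_pairP; split; first exact: (measurable_rV_coord ord0).
apply/measurable_fun_rVP => i.
rewrite (_ : _ \o _ = rV_coord (lift ord0 i)); first exact: measurable_rV_coord.
by apply/funext => x; rewrite /rV_coord /= mxE.
Qed.

Section lebesgue_rV_step.
Variables (n : nat) (mu : {sigma_finite_measure set 'rV[R]_n -> \bar R}).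

Definition lebesgue_rV_step : set 'rV[R]_n.+1 -> \bar R :=
  pushforward (lebesgue_measure \x mu)%E (@consrV n).

HB.instance Definition _ := Measure.copy lebesgue_rV_step
  (measure_function_pushforward__canonical__measure_function_Measure
     (lebesgue_measure \x mu)%E (@measurable_consrV n)).

Let lebesgue_rV_step_sigma_finite : sigma_finite setT lebesgue_rV_step.
Proof.
have /sigma_finiteP[F [FT ndF Foo]] := sigma_finiteT (@lebesgue_measure R).
have /sigma_finiteP[G [GT ndG Goo]] := sigma_finiteT mu.
exists (fun k => @unconsrV n @^-1` (F k `*` G k)).
  rewrite -preimage_bigcup -[LHS](preimage_setT (@unconsrV n)); congr preimage.
  rewrite -setXTT FT GT predeqE => -[x y]; split=> [[/= [i _ Fx] [j _ Gy]]|].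
    exists (maxn i j) => //; split.
    - by move: x Fx; exact/subsetPset/ndF/leq_maxl.
    - by move: y Gy; exact/subsetPset/ndG/leq_maxr.
  by move=> [i _ []/= ? ?]; split; exists i.
move=> k; have [mF Fk] := Foo k; have [mG Gk] := Goo k; split.
  rewrite -[X in measurable X]setTI.
  by apply: measurable_unconsrV => //; exact: measurableX.
rewrite /lebesgue_rV_step /pushforward -comp_preimage.
rewrite (_ : _ \o _ = id) ?preimage_id; last exact/funext/consrVK.
by rewrite product_measure1E// lte_mul_pinfty// ge0_fin_numE.
Qed.

HB.instance Definition _ := Measure_isSigmaFinite.Build _ _ _
  lebesgue_rV_step lebesgue_rV_step_sigma_finite.

End lebesgue_rV_step.

Fixpoint lebesgue_rV (n : nat) : {sigma_finite_measure set 'rV[R]_n -> \bar R} :=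
  if n is m.+1 then lebesgue_rV_step (lebesgue_rV m) else \d_(0 : 'rV[R]_0).

Lemma measurable_rV_box n (A : 'I_n -> set (measurableTypeR R)) :
  (forall i, measurable (A i)) ->
  measurable [set x : 'rV[R]_n | forall i, A i (x 0 i)].
Proof.
move=> mA.
rewrite (_ : [set _ | _] = \big[setI/setT]_(i < n) (rV_coord i @^-1` A i)).
  apply: bigsetI_measurable => i _; rewrite -[X in measurable X]setTI.
  exact: measurable_rV_coord.
rewrite -bigcap_seq; apply/seteqP; split=> x /= h i; first by move=> _; exact: h.
by apply: h => /=; rewrite mem_index_enum.
Qed.

Lemma lebesgue_rV_box n (A : 'I_n -> set (measurableTypeR R)) :
  (forall i, measurable (A i)) ->
  lebesgue_rV n [set x : 'rV[R]_n | forall i, A i (x 0 i)] =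
  (\prod_(i < n) lebesgue_measure (A i))%E.
Proof.
elim: n A => [|n IH] A mA.
  by rewrite big_ord0 /= diracE mem_set//= => -[].
rewrite big_ord_recl -IH//= /lebesgue_rV_step /pushforward.
rewrite -product_measure1E//; last first.
  exact: (@measurable_rV_box n (fun i => A (lift ord0 i))).
congr (_ _); apply/seteqP; split=> [[a x] /= h|[a x] [/= h0 h] i].
  split=> [|i].
    by have := h ord0; rewrite mxE unlift_none.
  by have := h (lift ord0 i); rewrite mxE liftK.
by rewrite mxE; case: unliftP => [j|] ->.
Qed.

End lebesgue_rV.

Section functions_on_Rd.
Context {R : realType} {d : nat}.
Implicit Types (x y : 'rV[R]_d) (g : 'rV[R]_d -> R).

(* The norm [`|x|] of the library on ['rV[R]_d] is the sup norm. *)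
Definition enorm x : R := Num.sqrt (\sum_(i < d) x 0 i ^+ 2).

Definition grad g x : 'rV[R]_d := \row_i 'D_(delta_mx 0 i) g x.

Definition continuously_differentiable g :=
  (forall x, differentiable g x) /\ continuous (grad g).

Definition compactly_supported g := compact (closure [set x | g x != 0]).

Definition radial g := exists phi : R -> R, forall x, g x = phi (enorm x).

Definition C1c_rad : set ('rV[R]_d -> R) :=
  [set g | [/\ continuously_differentiable g, compactly_supported g & radial g]].

Local Open Scope ereal_scope.

(* On the null set [x = y] both integrands below are [0], since
   [0 `^ a = 0] for [a != 0] and division by [0] gives [0]. *)
Definition sobolev_seminorm (s p : R) g : \bar R :=
  if (s == 1)%R then (\int[lebesgue_rV d]_x (enorm (grad g x) `^ p)%:E) `^ p^-1
  else (\int[lebesgue_rV d]_y \int[lebesgue_rV d]_x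
          (`|g x - g y| `^ p / enorm (x - y) `^ (d%:R + s * p))%:E) `^ p^-1.

Definition coulomb_energy (alpha q : R) g : \bar R :=
  \int[lebesgue_rV d]_y \int[lebesgue_rV d]_x
     (`|g x| `^ q * `|g y| `^ q / enorm (x - y) `^ (d%:R - alpha))%:E.

End functions_on_Rd.

(* Main.v *)
(** The test functions are sums of thin annular bumps
    g = sum_k lam_k * psi((|x|^2 - a_k^2) / (a_k w_k)), with radii a_k, widths
    w_k <= a_k / 4 and pairwise disjoint supports. For one bump, and d >= 2,
      int |g|^gamma ~ lam^gamma a^(d-1) w,
      |g|_{W^{s,p}}^p <= C lam^p a^(d-1) w^(1-sp),
      Coulomb energy <= C lam^(2q) a^(d+alpha-2) w^2,
    the last one because alpha > 1 makes |x|^(alpha-d) integrable on surfaces.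
    If beta1 gamma + (d+alpha-2)/(d-1) beta2 gamma < 1, letting a -> oo with
    lam = w = 1 violates the inequality. If there is equality, the parameters
    for which all three quantities equal 1 form a curve
    (lam, a, w) = (T^l, T^rho, T^tau); the condition q(1-sp) <> p says that
    rho <> 0, and p(d+alpha) - 2q(d-sp) <> 0 says that tau <> rho, so that the
    annuli can be made thin. Superposing N such bumps at widely separated scales
    makes the first two quantities of order N, and the Coulomb energy too because the
    interaction of two annuli decays like (a_j / a_k)^((d-alpha)/2); this gives
    N <= C N^((beta1+beta2) gamma), where (beta1 + beta2) gamma < 1. *)
Require Import Defs.
From mathcomp Require Import all_boot all_order all_algebra.
From mathcomp Require Import all_classical all_reals all_analysis.
From mathcomp Require Import measurable_realfun.
From mathcomp Require Import ring lra.
Set Implicit Arguments.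
Unset Strict Implicit.
Unset Printing Implicit Defensive.
Import Order.TTheory GRing.Theory Num.Theory.
Import numFieldNormedType.Exports.
Local Open Scope classical_set_scope.
Local Open Scope ring_scope.

(** * Iterated integrals over coordinates *)

(** No surface measure or polar coordinates enter: every integral is a Cartesian iterated one. The
    singular kernels are dominated by products of one-variable functions of x_j - y_j, and a set
    that is thin in one direction is integrated separately in that direction. The Coulomb kernel, of
    exponent alpha - d > 1 - d, fits into d - 1 factors, which leaves one coordinate free to record
    the width w; this uses alpha > 1. The Gagliardo kernel, cut off at scale w, takes all d factors,
    and there the remaining power of w comes from the volume of the annulus. Disjoint supports
    remove the interactions from the Sobolev term but not from the Coulomb term, and only the latter
    has to be controlled by separating scales. The critical exponents (l, rho, tau) are, up to sign,
    the cross product of the exponent vectors of the Sobolev and Coulomb quantities. The scaling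
    identities and criticality make the vector of the L^gamma quantity a combination of these two,
    so that the third relation follows. *)

(* No measurability is assumed: the integral of a nonnegative function is a
   supremum over the simple functions below it. *)
Lemma le_integral_ge0 d (T : measurableType d) (R : realType)
    (mu : {measure set T -> \bar R}) (f g : T -> \bar R) :
  (forall x, 0 <= f x)%E -> (forall x, f x <= g x)%E ->
  (\int[mu]_x f x <= \int[mu]_x g x)%E.
Proof.
move=> f0 fg.
have g0 x : (0 <= g x)%E by exact: le_trans (f0 x) (fg x).
rewrite !ge0_integralTE//; apply: le_ereal_sup => _ [h hf <-]; exists h => //.
by move=> x; exact: le_trans (hf x) (fg x).
Qed.

Lemma emeasurable_prod d (T : measurableType d) (R : realType) (I : Type)
    (r : seq I) (P : pred I) (f : I -> T -> \bar R) :
  (forall i, measurable_fun setT (f i)) ->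
  measurable_fun setT (fun x => \prod_(i <- r | P i) f i x)%E.
Proof.
move=> mf; elim: r => [|i r IH].
  by under eq_fun do rewrite big_nil; exact: measurable_cst.
under eq_fun do rewrite big_cons.
by case: (P i) => //; exact: emeasurable_funM.
Qed.

Lemma le_eprod (R : realType) (I : Type) (r : seq I) (P : pred I)
    (f g : I -> \bar R) :
  (forall i, P i -> 0 <= f i)%E -> (forall i, P i -> f i <= g i)%E ->
  (\prod_(i <- r | P i) f i <= \prod_(i <- r | P i) g i)%E.
Proof.
move=> f0 fg; elim: r => [|i r IH]; first by rewrite !big_nil.
rewrite !big_cons; case: ifPn => // Pi.
by apply: lee_pmul => //; [exact: f0|exact: prode_ge0|exact: fg].
Qed.

Section iterated.
Context {R : realType}.
Implicit Types n : nat.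
Local Open Scope ereal_scope.
Local Notation mR := (measurableTypeR R).

Lemma measurable_consrVl n (y : 'rV[R]_n) :
  measurable_fun setT (fun t : mR => consrV (t, y)).
Proof.
apply: (@measurableT_comp _ _ _ _ _ _ (@consrV R n)) => //.
exact: measurable_consrV.
Qed.

Lemma measurable_consrVr n (t : mR) :
  measurable_fun setT (fun y : 'rV[R]_n => consrV (t, y)).
Proof.
apply: (@measurableT_comp _ _ _ _ _ _ (@consrV R n)) => //.
exact: measurable_consrV.
Qed.

Lemma consrV_ord0 n (t : mR) (y : 'rV[R]_n) : consrV (t, y) ord0 ord0 = t.
Proof. by rewrite /consrV mxE unlift_none. Qed.

Lemma consrV_lift n (t : mR) (y : 'rV[R]_n) i :
  consrV (t, y) ord0 (lift ord0 i) = y ord0 i.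
Proof. by rewrite /consrV mxE liftK. Qed.

Variables (n : nat) (f : 'rV[R]_n.+1 -> \bar R).
Hypotheses (mf : measurable_fun setT f) (f0 : forall x, 0 <= f x).

Let mfc : measurable_fun setT (f \o @consrV R n).
Proof. exact: measurableT_comp (@measurable_consrV R n). Qed.

Let lebesgue_rV_pushforward :
  \int[lebesgue_rV n.+1]_x f x =
  \int[(lebesgue_measure \x lebesgue_rV n)]_z (f \o @consrV R n) z.
Proof.
have := @ge0_integral_pushforward _ _ (mR * 'rV[R]_n)%type 'rV[R]_n.+1 R
  (@consrV R n) (@measurable_consrV R n) (lebesgue_measure \x lebesgue_rV n) setT f.
by rewrite preimage_setT; apply.
Qed.

Lemma integral_rVS1 : \int[lebesgue_rV n.+1]_x f x =
  \int[lebesgue_measure]_t \int[lebesgue_rV n]_y f (consrV (t, y)).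
Proof. by rewrite lebesgue_rV_pushforward fubini_tonelli1//= => x; exact: f0. Qed.

(** Both orders are used: a distinguished first coordinate has to be integrated innermost, any other
    first coordinate outermost. *)
Lemma integral_rVS2 : \int[lebesgue_rV n.+1]_x f x =
  \int[lebesgue_rV n]_y \int[lebesgue_measure]_t f (consrV (t, y)).
Proof.
by rewrite lebesgue_rV_pushforward fubini_tonelli1//= ?fubini_tonelli//= => x;
  exact: f0.
Qed.

End iterated.

Section tensor.
Context {R : realType}.
Local Open Scope ereal_scope.
Local Notation mR := (measurableTypeR R).

Lemma measurable_tensor n (P : pred 'I_n) (f : 'I_n -> mR -> \bar R) :
  (forall i, measurable_fun setT (f i)) ->
  measurable_fun setT (fun x : 'rV[R]_n => \prod_(i < n | P i) f i (x ord0 i)).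
Proof.
move=> mf; apply: (@emeasurable_prod _ _ _ _ _ _ (fun i (x : 'rV[R]_n) => f i (x ord0 i))) => i.
exact: (measurableT_comp (mf i) (@measurable_rV_coord R n i)).
Qed.

Lemma integral_tensor n (f : 'I_n -> mR -> \bar R) :
  (forall i, measurable_fun setT (f i)) -> (forall i t, 0 <= f i t) ->
  \int[lebesgue_rV n]_x \prod_(i < n) f i (x ord0 i) =
  \prod_(i < n) \int[lebesgue_measure]_t f i t.
Proof.
elim: n f => [|n IH] f mf f0.
  rewrite big_ord0; under eq_integral do rewrite big_ord0.
  by rewrite integral_cst//= diracE mem_set// mule1.
rewrite big_ord_recl integral_rVS1; last 2 first.
- exact: (@measurable_tensor _ xpredT).
- by move=> x; exact: prode_ge0.
under eq_integral => t _.
  under eq_integral => y _.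
    rewrite big_ord_recl consrV_ord0.
    under eq_bigr => i _ do rewrite consrV_lift.
    over.
  rewrite ge0_integralZl//=; first last.
  - by move=> y _; exact: prode_ge0.
  - exact: (@measurable_tensor _ xpredT (fun i => f (lift ord0 i))).
  rewrite (IH (fun i => f (lift ord0 i)))//.
  rewrite muleC.
  over.
rewrite ge0_integralZl//; first by rewrite muleC.
by apply: prode_ge0 => i _; exact: integral_ge0.
Qed.

Definition update_coord n (i : 'I_n) (x : 'rV[R]_n) (t : R) : 'rV[R]_n :=
  \row_j if j == i then t else x ord0 j.

(** If every line in direction [i] meets [S] in length at most [L], that coordinate contributes [L]
    whatever factors sit on the others. A thin set is thus integrated against a product kernel by
    spending its thinness in one direction and the kernel in the remaining ones. *)
Lemma integral_slice n (i : 'I_n) (f : 'I_n -> mR -> \bar R)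
    (S : set 'rV[R]_n) (L : \bar R) :
  0 <= L -> measurable S ->
  (forall i, measurable_fun setT (f i)) -> (forall i t, 0 <= f i t) ->
  (forall x, lebesgue_measure [set t : mR | S (update_coord i x t)] <= L) ->
  \int[lebesgue_rV n]_x ((\1_S x)%:E * \prod_(j < n | j != i) f j (x ord0 j)) <=
  L * \prod_(j < n | j != i) \int[lebesgue_measure]_t f j t.
Proof.
move=> L0; elim: n i f S => [[]//|n IH] i f S mS mf f0 SL.
have mF : measurable_fun setT (fun x : 'rV[R]_n.+1 =>
    (\1_S x)%:E * \prod_(j < n.+1 | j != i) f j (x ord0 j)).
  apply: emeasurable_funM; last exact: measurable_tensor.
  by apply/measurable_EFinP; exact: measurable_indic.
have F0 (x : 'rV[R]_n.+1) :
    0 <= (\1_S x)%:E * \prod_(j < n.+1 | j != i) f j (x ord0 j).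
  by apply: mule_ge0; [rewrite lee_fin|exact: prode_ge0].
have mSl y : measurable [set t : mR | S (consrV (t, y))].
  by rewrite -[X in measurable X]setTI; exact: measurable_consrVl.
have mSr t : measurable [set y : 'rV[R]_n | S (consrV (t, y))].
  by rewrite -[X in measurable X]setTI; exact: measurable_consrVr.
case: (unliftP ord0 i) mF F0 SL => [k ->|->] mF F0 SL.
(* [i] is not the first coordinate: the slice of [S] at a fixed first coordinate satisfies the same
   hypothesis in one dimension less. *)
- rewrite integral_rVS1//.
  have E (g : 'I_n.+1 -> \bar R) : \prod_(j < n.+1 | j != lift ord0 k) g j =
      g ord0 * \prod_(j < n | j != k) g (lift ord0 j).
    rewrite big_mkcond big_ord_recl/=; congr (_ * _).
    by rewrite [RHS]big_mkcond; apply: eq_bigr => j _; rewrite (inj_eq lift_inj).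
  rewrite E muleCA [leRHS]muleC -ge0_integralZl//; last first.
    by rewrite mule_ge0//; apply: prode_ge0 => j _; exact: integral_ge0.
  apply: le_integral_ge0 => t; first by apply: integral_ge0 => y _; exact: F0.
  under eq_integral => y _.
    rewrite E consrV_ord0 muleCA.
    under eq_bigr => j _ do rewrite consrV_lift.
    over.
  rewrite ge0_integralZl//; first last.
  + by move=> y _; apply: mule_ge0; [rewrite lee_fin|exact: prode_ge0].
  + apply: emeasurable_funM.
      apply/measurable_EFinP.
      apply: (@measurableT_comp _ _ _ _ _ _ (\1_S : _ -> R)) => //.
      exact: measurable_consrVr.
    exact: (@measurable_tensor _ _ (fun j => f (lift ord0 j))).
  rewrite [leRHS]muleC; apply: lee_wpmul2l => //.
  apply: (IH k (fun j => f (lift ord0 j)) _ (mSr t)) => // y.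
  apply: le_trans (SL (consrV (t, y))); rewrite le_eqVlt; apply/orP; left.
  apply/eqP; congr (lebesgue_measure _); apply/seteqP.
  have V u : consrV (t, update_coord k y u) = update_coord (lift ord0 k) (consrV (t, y)) u.
    apply/rowP => j; rewrite /consrV /update_coord !mxE/=.
    case: unliftP => [l ->|->]; last by rewrite (negPf (neq_lift _ _)).
    by rewrite (inj_eq lift_inj) !mxE.
  by split=> u /=; rewrite (V u).
(* [i] is the first coordinate: the other factors do not depend on it, so the inner integral is the
   length of a slice. *)
- rewrite integral_rVS2//.
  have E (g : 'I_n.+1 -> \bar R) : \prod_(j < n.+1 | j != ord0) g j =
      \prod_(j < n) g (lift ord0 j).
    rewrite big_mkcond big_ord_recl/= mul1e; exact: eq_bigr.
  rewrite E -integral_tensor// -ge0_integralZl//; last 2 first.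
  + exact: (@measurable_tensor _ xpredT (fun j => f (lift ord0 j))).
  + by move=> y _; exact: prode_ge0.
  apply: le_integral_ge0 => y; first by apply: integral_ge0 => t _; exact: F0.
  under eq_integral => t _.
    rewrite E muleC.
    under eq_bigr => j _ do rewrite consrV_lift.
    over.
  rewrite ge0_integralZl//; first last.
  + apply: prode_ge0 => j _; exact: f0.
  + apply/measurable_EFinP.
    apply: (@measurableT_comp _ _ _ _ _ _ (\1_S : _ -> R)) => //.
    exact: measurable_consrVl.
  rewrite muleC; apply: lee_wpmul2r; first exact: prode_ge0.
  rewrite (_ : (fun t => _) = (fun t : mR => (\1_[set t : mR | S (consrV (t, y))] t)%:E))//.
  rewrite integral_indic// setIT.
  apply: le_trans (SL (consrV (0%R, y))); rewrite le_eqVlt; apply/orP; left.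
  apply/eqP; congr (lebesgue_measure _); apply/seteqP.
  have V u : consrV (u, y) = update_coord ord0 (consrV (0%R, y)) u.
    apply/rowP => j; rewrite /consrV /update_coord !mxE/=.
    by case: unliftP => [l ->|->]//; rewrite eq_sym (negPf (neq_lift _ _)).
  by split=> u /=; rewrite (V u).
Qed.

End tensor.

(** * An integrable majorant of homogeneous kernels *)

Lemma indic_bool (R : realType) (T : Type) (P : pred T) (x : T) :
  \1_[set y | P y] x = (P x)%:R :> R.
Proof. by rewrite indicE; congr (_%:R); congr nat_of_bool; apply/idP/idP; rewrite inE. Qed.

Section kernel_majorant.
Context {R : realType}.
Local Notation mR := (measurableTypeR R).

Lemma powR_le_base_anti (a b r : R) : 0 < a -> a <= b -> r <= 0 -> b `^ r <= a `^ r.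
Proof.
move=> a0 ab r0; have b0 : 0 < b by exact: lt_le_trans ab.
rewrite -[r]opprK (powRN b) (powRN a) lef_pV2 ?posrE ?powR_gt0//.
have r0' : 0 <= - r by rewrite oppr_ge0.
by apply: (ge0_ler_powR r0') => //; rewrite nnegrE ltW.
Qed.

Lemma powR_le_base (a b r : R) : 0 <= a -> a <= b -> 0 <= r -> a `^ r <= b `^ r.
Proof.
by move=> a0 ab r0; apply: (ge0_ler_powR r0) => //; rewrite nnegrE// (le_trans a0).
Qed.

Lemma dyadic_between (x : R) : 1 <= x -> exists k, 2 ^+ k <= x < 2 ^+ k.+1.
Proof.
move=> x1; have : exists n, x < 2 ^+ n.
  exists (Num.bound x); apply: (lt_le_trans (archi_boundP _)).
    exact: le_trans x1.
  by rewrite -natrX ler_nat ltnW// ltn_expl.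
case/ex_minnP => -[|k] kx kmin; first by move: kx; rewrite expr0 ltNge x1.
exists k; rewrite kx andbT leNgt; apply/negP => /kmin.
by rewrite ltnn.
Qed.

Lemma affine_ballE (x r e : R) : 0 < r ->
  [set t : mR | `|(t - x) / r| <= e] = `[x - r * e, x + r * e]%classic.
Proof.
move=> r0; apply/seteqP; split=> t /=;
  rewrite normrM (gtr0_norm (x := r^-1)) ?invr_gt0// ler_pdivrMr// ler_norml in_itv/=;
  by move=> /andP[? ?]; apply/andP; split; lra.
Qed.

Lemma lebesgue_measure_affine_ball (x r e : R) : 0 < r -> 0 < e ->
  lebesgue_measure [set t : mR | `|(t - x) / r| <= e] = (2 * r * e)%:E.
Proof.
move=> r0 e0; rewrite affine_ballE// lebesgue_measure_itv/= lte_fin ifT; last by nra.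
by rewrite -EFinB; congr EFin; lra.
Qed.

Lemma integral_affine_ball (x r e : R) : 0 < r -> 0 < e ->
  (\int[lebesgue_measure]_(t in [set: mR])
    (\1_[set t : mR | (`|(t - x) / r| <= e)%R] t)%:E = (2 * r * e)%:E)%E.
Proof.
move=> r0 e0; rewrite -(lebesgue_measure_affine_ball x r0 e0) integral_indic ?setIT//.
by rewrite affine_ballE//; exact: measurable_itv.
Qed.

Variable eps : R.
Hypotheses (eps0 : 0 < eps) (eps1 : eps <= 1).

Let th : R := 2 `^ (- eps).

Let th0 : 0 < th. Proof. exact: powR_gt0. Qed.

Let th1 : th < 1.
Proof.
rewrite /th powRN invf_lt1 ?powR_gt0//.
have : 1 `^ eps < 2 `^ eps by apply: (gt0_ltr_powR eps0); rewrite ?nnegrE ?ltr1n.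
by rewrite powR1.
Qed.

(** [a k] is v^(eps - 1) at v = 2^-(k+1) and [b k] is v^(-1 - eps) at v = 2^k, the largest values of
    the two profiles on the dyadic shells that they serve. Multiplied by the lengths of the balls in
    [term] they give geometric sequences of ratio [th]. *)
Let a k : R := 2 ^+ k.+1 * th ^+ k.+1.
Let b k : R := (2 ^+ k)^-1 * th ^+ k.

Let a0 k : 0 <= a k. Proof. by rewrite mulr_ge0// exprn_ge0// ltW. Qed.

Let b0 k : 0 <= b k.
Proof. by rewrite mulr_ge0 ?invr_ge0 ?exprn_ge0// ltW. Qed.

Let th_expn m : 2 `^ (- (eps * m%:R)) = th ^+ m.
Proof. by rewrite -mulNr powRrM powR_mulrn// powR_ge0. Qed.

(** Whole balls instead of dyadic shells, so that the sum is nonincreasing in |v|. *)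
Let term k (v : mR) : R :=
  a k * \1_[set v : mR | `|v| <= (2 ^+ k)^-1] v +
  b k * \1_[set v : mR | `|v| <= 2 ^+ k.+1] v.

Let h (v : mR) : \bar R := (\sum_(0 <= k <oo) (term k v)%:E)%E.

Let term_ge0 k v : 0 <= term k v.
Proof. by rewrite addr_ge0// mulr_ge0// indicE. Qed.

Let mball (r : R) : measurable [set v : mR | `|v| <= r].
Proof.
rewrite (_ : [set v : mR | _] = `[- r, r]%classic); first exact: measurable_itv.
by apply/seteqP; split => v /=; rewrite in_itv/= ler_norml.
Qed.

Let mterm k : measurable_fun setT (term k).
Proof.
by apply: measurable_funD; apply: measurable_funM => //; exact: measurable_indic.
Qed.

Let mh : measurable_fun setT h.
Proof.
apply: (@emeasurable_fun_cvg _ _ _ setT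
  (fun n v => \sum_(0 <= k < n) (term k v)%:E)%E) => //.
- move=> n; apply: emeasurable_sum => k.
  exact/measurable_EFinP.
- by move=> v _; apply: is_cvg_nneseries => n _ _; rewrite lee_fin.
Qed.

Let hN v : h (- v) = h v.
Proof.
rewrite /h; congr (limn _); apply/funext => n; apply: eq_bigr => k _.
by rewrite /term !indic_bool !normrN.
Qed.

Let h_lb k v : ((term k v)%:E <= h v)%E.
Proof.
apply: (@le_trans _ _ (\sum_(0 <= i < k.+1) (term i v)%:E)%E).
  rewrite big_nat_recr//= leeDr//; apply: sume_ge0 => i _.
  by rewrite lee_fin.
by apply: nneseries_lim_ge => i _ _; rewrite lee_fin.
Qed.

(** A single term of the series suffices, the one at the dyadic scale of [rho]: small scales are
    served by [a k], large ones by [b k]. Its ball contains [v] because |v| <= rho. *)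
Let h_ge (rho v : R) : 0 < rho -> `|v| <= rho ->
  ((Num.min (rho `^ (eps - 1)) (rho `^ (- 1 - eps)))%:E <= h v)%E.
Proof.
move=> rho0 vrho; have [rho1|/ltW rho1] := leP rho 1.
  have /dyadic_between[k /andP[k1 k2]] : 1 <= rho^-1 by rewrite invf_ge1.
  apply: le_trans (h_lb k v); rewrite lee_fin.
  apply: (@le_trans _ _ (a k)).
    rewrite ge_min; apply/orP; left.
    apply: (@le_trans _ _ (((2 ^+ k.+1)^-1) `^ (eps - 1))).
      apply: powR_le_base_anti; rewrite ?invr_gt0 ?exprn_gt0 ?subr_le0//.
      by rewrite -[leRHS]invrK lef_pV2 ?posrE ?exprn_gt0 ?invr_gt0// ltW.
    rewrite -powR_invn// -powRrM.
    rewrite (_ : - k.+1%:R * (eps - 1) = k.+1%:R + (- (eps * k.+1%:R))); last by ring.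
    by rewrite powRD ?pnatr_eq0 ?implybT// th_expn powR_mulrn.
  rewrite /term !indic_bool (_ : (`|v| <= (2 ^+ k)^-1) = true); last first.
    rewrite (le_trans vrho)// -[leLHS]invrK lef_pV2 ?posrE ?exprn_gt0 ?invr_gt0//.
  by rewrite mulr1 lerDl mulr_ge0.
have /dyadic_between[k /andP[k1 k2]] := rho1.
apply: le_trans (h_lb k v); rewrite lee_fin.
apply: (@le_trans _ _ (b k)).
  rewrite ge_min; apply/orP; right.
  apply: (@le_trans _ _ ((2 ^+ k) `^ (- 1 - eps))).
    by apply: powR_le_base_anti; rewrite ?exprn_gt0// -opprD oppr_le0 addr_ge0 ?ltW.
  rewrite -powR_mulrn// -powRrM.
  rewrite (_ : k%:R * (- 1 - eps) = - k%:R + (- (eps * k%:R))); last by ring.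
  by rewrite powRD ?pnatr_eq0 ?implybT// th_expn powR_invn.
rewrite /term !indic_bool (_ : (`|v| <= 2 ^+ k.+1) = true); last by rewrite (le_trans vrho) ?ltW.
by rewrite mulr1 lerDr mulr_ge0.
Qed.

Let integral_term (x r : R) k : 0 < r ->
  (\int[lebesgue_measure]_(t in [set: mR]) (term k ((t - x) / r))%:E <=
    (8 * r * th ^+ k)%:E)%E.
Proof.
move=> r0.
have E (e c : R) : 0 < e -> 0 <= c ->
    (\int[lebesgue_measure]_(t in [set: mR])
      (c * \1_[set v : mR | (`|v| <= e)%R] ((t - x) / r))%:E = (c * (2 * r * e))%:E)%E.
  move=> e0 c0.
  under eq_integral => t _ do
    rewrite EFinM indic_bool -(indic_bool R (fun t : mR => `|(t - x) / r| <= e)).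
  have mB : measurable [set t : mR | `|(t - x) / r| <= e].
    by rewrite affine_ballE//; exact: measurable_itv.
  rewrite ge0_integralZl//; last by apply/measurable_EFinP; exact: measurable_indic.
  by rewrite integral_affine_ball.
under eq_integral do rewrite EFinD.
have mT (e c : R) : measurable_fun [set: mR] (fun t : mR =>
    (c * \1_[set v : mR | `|v| <= e] ((t - x) / r))%:E).
  apply/measurable_EFinP; apply: measurable_funM => //.
  apply: (@measurableT_comp _ _ _ _ _ _ (\1_[set v : mR | `|v| <= e] : mR -> R)).
    exact: measurable_indic.
  by apply: measurable_funM => //; exact: measurable_funB.
rewrite ge0_integralD//; first last.
- by move=> t _; rewrite lee_fin mulr_ge0// indicE.
- by move=> t _; rewrite lee_fin mulr_ge0// indicE.
rewrite !E ?invr_gt0 ?exprn_gt0// -EFinD lee_fin /a /b.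
have x0 : 0 < 2 ^+ k :> R by rewrite exprn_gt0.
have y0 : 0 <= th ^+ k by rewrite exprn_ge0// ltW.
rewrite !exprS.
(* The two balls contribute 4 r th^(k+1) and 4 r th^k; th < 1 gives the constant 8. *)
rewrite (_ : _ + _ = 4 * r * th * th ^+ k + 4 * r * th ^+ k); last by field; rewrite gt_eqF.
rewrite -mulrDl ler_wpM2r//.
have : r * th <= r by rewrite ler_piMr// ltW.
by rewrite -mulrA; move: (r * th) => u ur; lra.
Qed.

(* [h] dominates the nonincreasing function rho |-> |rho| ^ (-1) * min(|rho| ^ eps,
   |rho| ^ (- eps)), with value +oo at 0. By monotonicity a product of copies of
   [h] over coordinates dominates radial kernels in several variables. *)
Lemma kernel_majorant : exists (h : mR -> \bar R) (c : R),
  [/\ measurable_fun setT h, forall v, (0 <= h v)%E, forall v, h (- v) = h v,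
    forall rho v : R, 0 < rho -> `|v| <= rho ->
      ((Num.min (rho `^ (eps - 1)) (rho `^ (- 1 - eps)))%:E <= h v)%E &
    0 <= c /\ forall x r : R, 0 < r ->
      (\int[lebesgue_measure]_(t in [set: mR]) h ((t - x) / r)%R <= (c * r)%:E)%E].
Proof.
exists h, (8 / (1 - th)); split => //.
  by move=> v; apply: nneseries_ge0 => n _ _; rewrite lee_fin.
split; first by rewrite divr_ge0// subr_ge0 ltW.
move=> x r r0; rewrite /h integral_nneseries//; first last.
- by move=> n t _; rewrite lee_fin.
- move=> n; apply/measurable_EFinP; apply: (measurableT_comp (mterm n)).
  by apply: measurable_funM => //; exact: measurable_funB.
apply: lime_le.
  by apply: is_cvg_nneseries => n _ _; apply: integral_ge0 => t _; rewrite lee_fin.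
apply: nearW => n.
apply: (@le_trans _ _ (\sum_(0 <= k < n) (8 * r * th ^+ k)%:E)%E).
  by apply: lee_sum => k _; exact: integral_term.
rewrite sumEFin lee_fin.
have := @geometric_le_lim R n (8 * r) th.
by rewrite gtr0_norm// mulrAC; apply; rewrite // mulr_ge0// ltW.
Qed.

End kernel_majorant.

(** * Volume of annuli *)

Lemma eprod_le_cst (R : realType) (I : finType) (P : pred I) (f : I -> \bar R) (c : R) :
  (forall i, 0 <= f i)%E -> (forall i, f i <= c%:E)%E ->
  (\prod_(i | P i) f i <= (c ^+ #|P|)%:E)%E.
Proof.
move=> f0 fc; apply: (@le_trans _ _ (\prod_(i | P i) c%:E)%E); first exact: le_eprod.
by rewrite -(big_morph EFin (@EFinM R) erefl) prodr_const.
Qed.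

Section annulus.
Context {R : realType}.
Local Notation mR := (measurableTypeR R).

Definition sqn d (x : 'rV[R]_d) : R := \sum_(i < d) x ord0 i ^+ 2.

(** The thickness is comparable to [w], since |x|^2 - a^2 = (|x| - a)(|x| + a). The quadratic form
    keeps the slices along a coordinate explicit. *)
Definition annulus d (a w : R) : set 'rV[R]_d :=
  [set x | `|sqn x - a ^+ 2| <= a * w].

(** Away from the hyperplane x_i = 0 the lines in direction [i] cross the spheres transversally, so
    that slices have length of order [w]. *)
Definition annulus_piece d (i : 'I_d) (a w : R) : set 'rV[R]_d :=
  [set x | (`|sqn x - a ^+ 2| <= a * w) && (a ^+ 2 / (2 * d%:R) <= x ord0 i ^+ 2)].

Lemma sqn_ge0 d (x : 'rV[R]_d) : 0 <= sqn x.
Proof. by apply: sumr_ge0 => i _; exact: sqr_ge0. Qed.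

Lemma sqn_enorm d (x : 'rV[R]_d) : enorm x ^+ 2 = sqn x.
Proof. by rewrite sqr_sqrtr// sqn_ge0. Qed.

Lemma enorm_ge0 d (x : 'rV[R]_d) : 0 <= enorm x.
Proof. exact: sqrtr_ge0. Qed.

Lemma coord_sqn d (x : 'rV[R]_d) i : x ord0 i ^+ 2 <= sqn x.
Proof. by rewrite /sqn (bigD1 i)//= lerDl sumr_ge0// => j _; exact: sqr_ge0. Qed.

Lemma coord_enorm d (x : 'rV[R]_d) i : `|x ord0 i| <= enorm x.
Proof. by rewrite -sqrtr_sqr ler_wsqrtr// coord_sqn. Qed.

Lemma measurable_sqn d : measurable_fun setT (@sqn d).
Proof.
rewrite (_ : @sqn d = fun x => \sum_(i < d) x ord0 i ^+ 2)//.
apply: (@measurable_sum _ _ _ _ _ _ (fun i (x : 'rV[R]_d) => x ord0 i ^+ 2)) => i.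
by apply: measurable_funX; exact: measurable_rV_coord.
Qed.

Lemma measurable_annulus d a w : measurable (@annulus d a w).
Proof.
rewrite (_ : @annulus d a w = @sqn d @^-1` `[a ^+ 2 - a * w, a ^+ 2 + a * w]%classic).
  by rewrite -[X in measurable X]setTI; apply: measurable_sqn => //; exact: measurable_itv.
by apply/seteqP; split => x; rewrite /annulus/= in_itv/= ler_distl.
Qed.

Lemma measurable_annulus_piece d i a w : measurable (@annulus_piece d i a w).
Proof.
rewrite (_ : annulus_piece i a w = annulus a w `&`
   (fun x : 'rV[R]_d => (x ord0 i ^+ 2 : mR)) @^-1` `[a ^+ 2 / (2 * d%:R), +oo[%classic).
  apply: measurableI; first exact: measurable_annulus.
  rewrite -[X in measurable X]setTI.
  have mi : measurable_fun setT (fun x : 'rV[R]_d => (x ord0 i ^+ 2 : mR)).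
    by apply: measurable_funX; exact: measurable_rV_coord.
  by apply: mi => //; exact: measurable_itv.
apply/seteqP; split => x; rewrite /annulus_piece /annulus/= in_itv/= andbT.
  by move/andP.
by case=> -> ->.
Qed.

Lemma measurable_update_coord d (i : 'I_d) (x : 'rV[R]_d) :
  measurable_fun setT (fun t : mR => update_coord i x t).
Proof.
apply/measurable_fun_rVP => j; rewrite /rV_coord /comp /update_coord.
under eq_fun do rewrite mxE.
by case: eqP => _; [exact: measurable_id|exact: measurable_cst].
Qed.

(* On each half-line the map t |-> t ^+ 2 has slope at least a / d on the slice. *)
Lemma annulus_piece_slice d (i : 'I_d) (a w : R) (x : 'rV[R]_d) :
  0 < a -> 0 < w ->
  (lebesgue_measure [set t : mR | annulus_piece i a w (update_coord i x t)] <=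
    (8 * d%:R * w)%:E)%E.
Proof.
move=> a0 w0.
have d0 : 1 <= d%:R :> R by rewrite ler1n (leq_ltn_trans _ (ltn_ord i)).
set S := [set t : mR | _].
have mS : measurable S.
  rewrite -[X in measurable X]setTI.
  by apply: measurable_update_coord => //; exact: measurable_annulus_piece.
pose b := \sum_(j < d | j != i) x ord0 j ^+ 2.
have SE t : S t -> `|t ^+ 2 + b - a ^+ 2| <= a * w /\ a / (2 * d%:R) <= `|t|.
  move=> /= /andP[]; rewrite /sqn (bigD1 i)//= /update_coord !mxE eqxx.
  under eq_bigr => j ji do rewrite mxE (negPf ji).
  move=> h1 h2; split=> //.
  rewrite -(@ler_pXn2r _ 2) ?nnegrE//; last by rewrite divr_ge0 ?ltW ?mulr_gt0// (lt_le_trans _ d0).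
  rewrite real_normK ?num_real//; apply: le_trans h2.
  rewrite expr_div_n ler_pdivrMr; last by rewrite exprn_gt0// mulr_gt0// (lt_le_trans _ d0).
  rewrite -mulrA ler_peMr ?sqr_ge0//.
  rewrite expr2 mulrA mulVf ?mul1r; last by rewrite mulf_neq0// gt_eqF// (lt_le_trans _ d0).
  lra.
have close s t : S s -> S t -> 0 <= s * t -> `|s - t| <= 2 * d%:R * w.
  move=> /SE[s1 s2] /SE[t1 t2] st.
  have H : `|s - t| * (`|s| + `|t|) <= 2 * (a * w).
    have -> : `|s| + `|t| = `|s + t|.
      apply/eqP; rewrite -(@eqrXn2 _ 2)// ?addr_ge0//; apply/eqP.
      rewrite sqrrD !real_normK ?num_real// sqrrD -normrM ger0_norm//.
    rewrite -normrM; move: s1 t1; rewrite !ler_norml => /andP[? ?] /andP[? ?].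
    by apply/andP; split; nra.
  have dd : 0 < d%:R :> R by exact: lt_le_trans d0.
  have st2 : a / d%:R <= `|s| + `|t|.
    rewrite (_ : a / d%:R = a / (2 * d%:R) + a / (2 * d%:R)) ?lerD//.
    by field; rewrite gt_eqF.
  have H2 : `|s - t| * a <= 2 * (a * w) * d%:R.
    rewrite -ler_pdivrMr// -mulrA.
    by apply: le_trans H; rewrite ler_wpM2l.
  rewrite -(ler_pM2r a0); apply: le_trans H2 _.
  by rewrite le_eqVlt; apply/orP; left; apply/eqP; ring.
have half (s0 : R) (T : set mR) : measurable T -> T `<=` S ->
    (forall t, T t -> 0 <= s0 * t) -> T s0 ->
    (lebesgue_measure T <= (4 * d%:R * w)%:E)%E.
  move=> mT TS T0 Ts0.
  have -> : (4 * d%:R * w = (s0 + 2 * d%:R * w) - (s0 - 2 * d%:R * w))%R by lra.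
  apply: (@le_trans _ _ (lebesgue_measure
     (`[s0 - 2 * d%:R * w, s0 + 2 * d%:R * w]%classic : set mR))).
    apply: le_measure; rewrite ?inE//.
    move=> t Tt /=; rewrite in_itv/= -ler_distl distrC.
    exact: close (TS _ Ts0) (TS _ Tt) (T0 _ Tt).
  rewrite lebesgue_measure_itv/= lte_fin; case: ifPn => _; first by rewrite -EFinB.
  by rewrite lee_fin; nra.
have halfle (T : set mR) : measurable T -> T `<=` S ->
    (forall s t, T s -> T t -> 0 <= s * t) ->
    (lebesgue_measure T <= (4 * d%:R * w)%:E)%E.
  move=> mT TS T0; have [->|/set0P[s0 Ts0]] := eqVneq T set0.
    by rewrite measure0 lee_fin; nra.
  by apply: (half s0) => // t Tt; exact: T0.
have mI (J : interval R) : measurable ([set` J] : set mR) by exact: measurable_itv.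
(* By [close] two points of the slice with the same sign are at distance at most 2 d w. Each sign
   class therefore lies in an interval of length 4 d w around any of its points, and two classes
   give the factor 8. *)
have ST : S = (S `&` `[0, +oo[%classic) `|` (S `&` `]-oo, 0]%classic).
  rewrite -setIUr; apply/seteqP; split=> [t St|t []//]; split => //=.
  by rewrite !in_itv/= andbT; apply/orP; exact: le_total.
rewrite ST; apply: (le_trans (measureU2 _ _ _)); [exact: measurableI|exact: measurableI|].
rewrite (_ : 8 * _ * _ = 4 * d%:R * w + 4 * d%:R * w)%R; last by lra.
rewrite EFinD; apply: leeD; apply: halfle => //; try exact: measurableI.
- move=> s t [_] /=; rewrite in_itv/= andbT => s0 [_] /=; rewrite in_itv/= andbT => t0.
  exact: mulr_ge0.
- move=> s t [_] /=; rewrite in_itv/= => s0 [_] /=; rewrite in_itv/= => t0.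
  exact: mulr_le0.
Qed.

(** Otherwise |x|^2 would be at most a^2 / 2, whereas 4 w <= a forces |x|^2 >= 3 a^2 / 4 on the
    annulus. *)
Lemma annulus_cover d (a w : R) (x : 'rV[R]_d) :
  0 < a -> 4 * w <= a -> annulus a w x -> exists i, annulus_piece i a w x.
Proof.
move=> a0 wa xa; apply: contrapT => /forallNP nx.
have lt i : x ord0 i ^+ 2 < a ^+ 2 / (2 * d%:R).
  rewrite ltNge; apply/negP => h; apply: (nx i).
  by apply/andP; split.
have : sqn x <= a ^+ 2 / 2.
  rewrite /sqn; case: d x xa nx lt => [|d] x xa nx lt.
    by rewrite big_ord0 divr_ge0 ?sqr_ge0.
  apply: (@le_trans _ _ (\sum_(i < d.+1) a ^+ 2 / (2 * d.+1%:R))).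
    by apply: ler_sum => i _; exact: ltW.
  rewrite sumr_const card_ord -[_ *+ _]mulr_natr.
  by rewrite le_eqVlt; apply/orP; left; apply/eqP; field; rewrite nat1r pnatr_eq0.
by move: xa; rewrite /annulus/= ler_distl => /andP[h _]; nra.
Qed.

Lemma annulus_coord d (a w : R) (x : 'rV[R]_d) i :
  0 < a -> 4 * w <= a -> annulus a w x -> `|x ord0 i| <= 2 * a.
Proof.
move=> a0 wa xa; have := coord_sqn x i.
move: xa; rewrite /annulus/= ler_distl => /andP[_ h] h2.
have a2 : 0 <= 2 * a by lra.
by rewrite -(@ler_pXn2r _ 2) ?nnegrE// real_normK ?num_real//; nra.
Qed.

Lemma indic_annulus_le d (a w : R) (x : 'rV[R]_d) : 0 < a -> 4 * w <= a ->
  \1_(annulus a w) x <= \sum_(i < d) \1_(annulus_piece i a w) x :> R.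
Proof.
move=> a0 wa; have [xa|xa] := pselect (annulus a w x); last first.
  by rewrite indicE memNset// sumr_ge0// => i _; rewrite indicE.
have [i xi] := annulus_cover a0 wa xa.
by rewrite (bigD1 i)//= !indicE !mem_set// lerDl sumr_ge0// => j _; rewrite indicE.
Qed.

(** On each piece the distinguished coordinate contributes 8 (d+1) w and each other one the length 4
    a of [-2a, 2a]. The indicators of these intervals equal 1 on the annulus; they are inserted to
    bring the integrand into the form of [integral_slice]. *)
Lemma annulus_volume_le d : exists2 C : R, 0 < C & forall a w : R,
  0 < w -> 4 * w <= a ->
  (lebesgue_rV d.+1 (annulus a w) <= (C * (a ^+ d * w))%:E)%E.
Proof.
exists (d.+1%:R * (8 * d.+1%:R * 4 ^+ d)); first by rewrite !mulr_gt0// exprn_gt0.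
move=> a w w0 wa; have a0 : 0 < a by lra.
pose f (j : 'I_d.+1) (t : mR) : \bar R := (\1_[set t : mR | `|(t - 0) / 1| <= 2 * a] t)%:E.
have mball : measurable [set t : mR | `|(t - 0) / 1| <= 2 * a].
  by rewrite affine_ballE//; exact: measurable_itv.
have mf j : measurable_fun setT (f j).
  by apply/measurable_EFinP; exact: measurable_indic.
have f0 j t : (0 <= f j t)%E by rewrite lee_fin indicE.
pose P i (x : 'rV[R]_d.+1) :=
  ((\1_(annulus_piece i a w) x)%:E * \prod_(j < d.+1 | j != i) f j (x ord0 j))%E.
have P0 i x : (0 <= P i x)%E.
  by rewrite /P mule_ge0 ?lee_fin ?indicE//; exact: prode_ge0.
have mP i : measurable_fun setT (P i).
  apply: emeasurable_funM; last exact: measurable_tensor.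
  by apply/measurable_EFinP; apply: measurable_indic; exact: measurable_annulus_piece.
rewrite -[X in (lebesgue_rV d.+1 X)]setIT -integral_indic//; last exact: measurable_annulus.
apply: (@le_trans _ _ (\int[lebesgue_rV d.+1]_x \sum_(i < d.+1) P i x)%E).
  apply: le_integral_ge0 => x; first by rewrite lee_fin indicE.
  apply: (@le_trans _ _ (\sum_(i < d.+1) (\1_(annulus_piece i a w) x)%:E)%E).
    by rewrite sumEFin lee_fin; exact: indic_annulus_le.
  apply: lee_sum => i _; rewrite /P [\1__ _]indicE.
  have [|_] := boolP (x \in _); last by rewrite mul0e.
  rewrite inE => /andP[xa _]; rewrite big1 ?mule1// => j _.
  by rewrite /f indicE mem_set//= subr0 divr1; exact: annulus_coord xa.
rewrite ge0_integral_sum//.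
rewrite -!mulrA [X in (_ <= X%:E)%E]mulr_natl.
apply: (@le_trans _ _ (\sum_(i < d.+1) (8 * (d.+1%:R * (4 ^+ d * (a ^+ d * w))))%:E)%E); last first.
  by rewrite sumEFin sumr_const card_ord.
apply: lee_sum => i _.
apply: le_trans (@integral_slice _ _ i f _ (8 * d.+1%:R * w)%:E _ _ mf f0 _) _.
- by rewrite lee_fin mulr_ge0// ltW.
- exact: measurable_annulus_piece.
- by move=> x; exact: annulus_piece_slice.
have -> : (8 * (d.+1%:R * (4 ^+ d * (a ^+ d * w))) = 8 * d.+1%:R * w * (4 * a) ^+ d)%R.
  by rewrite exprMn; ring.
rewrite [leRHS]EFinM; apply: lee_wpmul2l; first by rewrite lee_fin mulr_ge0// ltW.
apply: le_trans (eprod_le_cst _ (c := 4 * a) _ _) _.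
- by move=> j; exact: integral_ge0.
- move=> j; rewrite integral_affine_ball//; last by lra.
  by rewrite lee_fin; lra.
- by rewrite (eq_card (B := predC1 i))// cardC1 card_ord.
Qed.

(** Above each point y of the cube |y_j| <= a / (2 (d+1)), where |y|^2 <= a^2 / 4, the annulus
    contains a segment of length w / 4 that starts on the sphere of radius [a]. The cube has volume
    (a / (d+1))^d. *)
Lemma annulus_volume_ge d : exists2 c : R, 0 < c & forall a w : R,
  0 < w -> 4 * w <= a ->
  ((c * (a ^+ d * w))%:E <= lebesgue_rV d.+1 (annulus a w))%E.
Proof.
exists (4^-1 * (d.+1%:R^-1) ^+ d); first by rewrite mulr_gt0// exprn_gt0// invr_gt0.
move=> a w w0 wa; have a0 : 0 < a by lra.
have dd : 1 <= d.+1%:R :> R by rewrite ler1n.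
have d0 : 0 < d.+1%:R :> R by [].
pose e : R := a / (2 * d.+1%:R).
have e0 : 0 < e by rewrite divr_gt0// mulr_gt0.
rewrite -[X in (lebesgue_rV d.+1 X)]setIT -integral_indic//; last exact: measurable_annulus.
rewrite integral_rVS2; first last.
- by move=> x; rewrite lee_fin indicE.
- by apply/measurable_EFinP; apply: measurable_indic; exact: measurable_annulus.
have mball : measurable [set t : mR | `|(t - 0) / 1| <= e].
  by rewrite affine_ballE//; exact: measurable_itv.
pose f (j : 'I_d) (t : mR) : \bar R := (\1_[set t : mR | `|(t - 0) / 1| <= e] t)%:E.
have mf j : measurable_fun setT (f j).
  by apply/measurable_EFinP; exact: measurable_indic.
have f0 j t : (0 <= f j t)%E by rewrite lee_fin indicE.
apply: (@le_trans _ _ (\int[lebesgue_rV d]_y ((w / 4)%:E * \prod_(j < d) f j (y ord0 j)))%E).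
  rewrite ge0_integralZl//; first last.
  - by rewrite lee_fin divr_ge0// ltW.
  - by move=> y _; exact: prode_ge0.
  - exact: measurable_tensor.
  rewrite integral_tensor//.
  under eq_bigr => j _.
    rewrite integral_affine_ball//.
    over.
  rewrite -(big_morph EFin (@EFinM R) erefl) prodr_const card_ord -EFinM lee_fin.
  rewrite le_eqVlt; apply/orP; left; apply/eqP.
  rewrite (_ : 2 * 1 * e = a / d.+1%:R)%R; last by rewrite /e; field; rewrite nat1r pnatr_eq0.
  by rewrite expr_div_n exprVn; ring.
apply: le_integral_ge0 => y.
  by apply: mule_ge0; [rewrite lee_fin divr_ge0// ltW|exact: prode_ge0].
have [yb|] := pselect (forall j, `|y ord0 j| <= e); last first.
  move=> /existsNP[j yj]; rewrite (bigD1 j)//= {1}/f indicE memNset/=.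
    by rewrite mul0e mule0; apply: integral_ge0 => t _; rewrite lee_fin indicE.
  by rewrite subr0 divr1.
rewrite big1 ?mule1; last by move=> j _; rewrite /f indicE mem_set//= subr0 divr1.
have yb2 : sqn y <= a ^+ 2 / 4.
  apply: (@le_trans _ _ (\sum_(j < d) e ^+ 2)).
    apply: ler_sum => j _; rewrite -[leLHS]real_normK ?num_real//.
    by rewrite ler_pXn2r ?nnegrE// ltW.
  rewrite sumr_const card_ord -[_ *+ _]mulr_natr /e expr_div_n exprMn.
  rewrite -mulrA ler_pM2l ?exprn_gt0// ler_pdivrMl ?mulr_gt0 ?exprn_gt0//.
  rewrite (_ : 2 ^+ 2 = 4 :> R); last by ring.
  rewrite mulrAC divff// mul1r expr2.
  apply: (@le_trans _ _ (d.+1%:R)); first by rewrite ler_nat.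
  by rewrite ler_peMr// ltW.
pose b := a ^+ 2 - sqn y.
have b0 : 0 <= b by rewrite /b; nra.
pose u := Num.sqrt b.
have u2 : u ^+ 2 = b by rewrite sqr_sqrtr.
have u0 : 0 <= u by exact: sqrtr_ge0.
have ua : u <= a.
  by rewrite -(@ler_pXn2r _ 2) ?nnegrE ?(ltW a0)// u2 /b; have := sqn_ge0 y; lra.
have mT : measurable [set t : mR | annulus a w (consrV (t, y))].
  rewrite -[X in measurable X]setTI; apply: measurable_consrVl => //.
  exact: measurable_annulus.
rewrite (_ : (fun t => _) = (fun t : mR => (\1_[set t : mR | annulus a w (consrV (t, y))] t)%:E))//.
rewrite integral_indic// setIT.
apply: (@le_trans _ _ (lebesgue_measure (`[u, u + w / 4]%classic : set mR))).
  rewrite lebesgue_measure_itv/= lte_fin ifT; last by lra.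
  by rewrite -EFinB lee_fin; lra.
apply: le_measure; rewrite ?inE//.
move=> t /=; rewrite in_itv/= => /andP[ut tu].
rewrite /annulus /sqn/= big_ord_recl consrV_ord0.
under eq_bigr => j _ do rewrite consrV_lift.
rewrite -/(sqn y) ler_distl.
have t2 : u ^+ 2 <= t ^+ 2 by rewrite ler_pXn2r ?nnegrE// (le_trans u0).
have t3 : t ^+ 2 <= (u + w / 4) ^+ 2.
  by rewrite ler_pXn2r ?nnegrE ?(le_trans u0)// lerDl; lra.
move: u2; rewrite /b => u2.
by apply/andP; split; nra.
Qed.

End annulus.

(** * Annular bumps *)

Section bump.
Context {R : realType}.

(** The square of the positive part, a C^1 function that vanishes on a half-line. Written as a
    product with [u], it displays its difference quotient at 0. *)
Definition pos_sqr (u : R) : R := u * Num.max 0 u.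

Lemma pos_sqrE u : pos_sqr u = Num.max 0 u ^+ 2.
Proof.
rewrite /pos_sqr; have [u0|u0] := leP 0 u; first by rewrite expr2.
by rewrite mulr0 expr0n.
Qed.

Lemma continuous_maxr0 : continuous (fun u : R => Num.max 0 u).
Proof.
move=> x; apply: (@continuous_max R R (cst 0) id); [exact: cst_continuous|exact: cvg_id].
Qed.

Lemma is_derive_pos_sqr (u : R) : is_derive u 1 pos_sqr (2 * Num.max 0 u).
Proof.
have [u0|u0|->] := ltgtP u 0.
- rewrite mulr0.
  apply: (@near_eq_is_derive _ _ _ (cst 0)).
  near=> z; rewrite /pos_sqr max_l ?mulr0//; apply: ltW; near: z.
  exact: lt_nbhsl.
- apply: (@near_eq_is_derive _ _ _ (fun z : R => z ^+ 2)).
  near=> z; rewrite /pos_sqr max_r ?expr2//; apply: ltW; near: z.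
  exact: lt_nbhsr.
  by apply: is_derive_eq; rewrite /GRing.scale/= !mulr1 -mulr2n mulr_natl.
- apply/is_derive1_caratheodory; exists (fun z => Num.max 0 z); split.
  + by move=> z; rewrite /pos_sqr mul0r !subr0 mulrC.
  + exact: continuous_maxr0.
  + by rewrite mulr0 maxxx.
Unshelve. all: by end_near. Qed.

Lemma differentiable_pos_sqr (u : R) : differentiable pos_sqr u.
Proof. by apply/derivable1_diffP; have [] := is_derive_pos_sqr u. Qed.

Lemma continuous_rV (T : topologicalType) d (f : T -> 'rV[R]_d) :
  (forall i, continuous (fun x => f x ord0 i)) -> continuous f.
Proof.
move=> cf x A [P fP PA]; apply: (@filterS _ (nbhs x) _
   [set y | forall i, P ord0 i (f y ord0 i)]).
  by move=> y yP; apply: PA => i j; rewrite ord1; exact: yP.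
apply: filter_forall => i; exact: (cf i x _ (fP ord0 i)).
Qed.

Lemma is_derive_coord d (x v : 'rV[R]_d) i :
  is_derive x v (fun y : 'rV[R]_d => y ord0 i) (v ord0 i).
Proof.
have H : (fun h => h^-1 *: ((h *: v + x) ord0 i - x ord0 i)) @ 0^' --> v ord0 i.
  apply: (@cvg_trans _ ((fun=> v ord0 i) @ (0 : R)^')); last exact: cvg_cst.
  apply: near_eq_cvg; near=> h; rewrite !mxE addrK /GRing.scale/= mulrA mulVf ?mul1r//.
  near: h; exact: nbhs_dnbhs_neq.
by apply: DeriveDef; [apply/cvg_ex; exists (v ord0 i)|apply: cvg_lim].
Unshelve. all: by end_near. Qed.

(* A profile in |x|^2 rather than |x|, so that it is polynomial in x. *)
Definition shell d (a w : R) (x : 'rV[R]_d) : R := (sqn x - a ^+ 2) / (a * w).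

Definition bump d (a w : R) (x : 'rV[R]_d) : R := pos_sqr (1 - shell a w x ^+ 2).

Definition bump_grad d (a w : R) (x : 'rV[R]_d) (i : 'I_d) : R :=
  2 * Num.max 0 (1 - shell a w x ^+ 2) * (- (2 * shell a w x * (2 * x ord0 i / (a * w)))).

Lemma differentiable_sqn d (x : 'rV[R]_d) : differentiable (@sqn R d) x.
Proof.
have -> : @sqn R d = \sum_(i < d) (fun y : 'rV[R]_d => y ord0 i) ^+ 2.
  by apply/funext => y; rewrite fct_sumE /sqn; apply: eq_bigr => i _.
by apply: differentiable_sum => i; apply: differentiableX; exact: differentiable_coord.
Qed.

Lemma is_derive_sqn d (x v : 'rV[R]_d) :
  is_derive x v (@sqn R d) (\sum_(i < d) 2 * x ord0 i * v ord0 i).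
Proof.
have -> : @sqn R d = \sum_(i < d) (fun y : 'rV[R]_d => y ord0 i) ^+ 2.
  by apply/funext => y; rewrite fct_sumE /sqn; apply: eq_bigr => i _.
apply: is_derive_sum => i.
by apply: (is_derive_eq (is_deriveX 2 (is_derive_coord x v i))); rewrite /= expr1.
Qed.

Let shell_fun d a w : (fun x : 'rV[R]_d => 1 - shell a w x ^+ 2) =
  cst 1 - ((a * w)^-1 \*: (@sqn R d - cst (a ^+ 2))) ^+ 2.
Proof.
apply/funext => x; rewrite /shell /GRing.add/= /GRing.opp/=.
by rewrite !fctE /= /GRing.scale/= mulrC.
Qed.

Lemma differentiable_bump d a w (x : 'rV[R]_d) : differentiable (@bump d a w) x.
Proof.
apply: (@differentiable_comp _ _ _ _ (fun x => 1 - shell a w x ^+ 2) pos_sqr).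
  rewrite shell_fun; apply: differentiableB; first exact: differentiable_cst.
  apply: differentiableX; apply: differentiableZ; apply: differentiableB.
    exact: differentiable_sqn.
  exact: differentiable_cst.
exact: differentiable_pos_sqr.
Qed.

Lemma is_derive_shell d a w (x v : 'rV[R]_d) :
  is_derive x v (@shell d a w) ((a * w)^-1 * \sum_(i < d) 2 * x ord0 i * v ord0 i).
Proof.
have -> : @shell d a w = (a * w)^-1 \*: (@sqn R d - cst (a ^+ 2)).
  by apply/funext => y; rewrite /shell mulrC.
apply: is_deriveZ; apply: (is_derive_eq (is_deriveB (is_derive_sqn x v) (is_derive_cst _ _ _))).
by rewrite subr0.
Qed.

Lemma is_derive_bump d a w (x v : 'rV[R]_d) :
  is_derive x v (@bump d a w) (2 * Num.max 0 (1 - shell a w x ^+ 2) *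
    (- (2 * shell a w x * ((a * w)^-1 * \sum_(i < d) 2 * x ord0 i * v ord0 i)))).
Proof.
have db := @differentiable_bump d a w x.
apply: DeriveDef; first exact: diff_derivable.
have dP : differentiable (fun x : 'rV[R]_d => 1 - shell a w x ^+ 2) x.
  rewrite shell_fun; apply: differentiableB; first exact: differentiable_cst.
  apply: differentiableX; apply: differentiableZ; apply: differentiableB.
    exact: differentiable_sqn.
  exact: differentiable_cst.
rewrite deriveE// (diff_comp dP (differentiable_pos_sqr _))/=.
rewrite diff1E; last exact: differentiable_pos_sqr.
rewrite /= derive1E (@derive_val _ _ _ _ _ _ _ (is_derive_pos_sqr _)) -deriveE//.
have H : is_derive x v (fun x : 'rV[R]_d => 1 - shell a w x ^+ 2)
    (0 - (2 * shell a w x ^+ 1) *: ((a * w)^-1 * \sum_(i < d) 2 * x ord0 i * v ord0 i)).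
  apply: is_deriveB; exact: (is_deriveX 2 (is_derive_shell a w x v)).
by rewrite (@derive_val _ _ _ _ _ _ _ H) expr1 sub0r /GRing.scale/= mulrC.
Qed.

End bump.

Section radial_bumps.
Context {R : realType} (d N : nat) (lam a w : 'I_N -> R).

Definition bumps (x : 'rV[R]_d) : R := \sum_(k < N) lam k * bump (a k) (w k) x.

Let bumps_fun : bumps = \sum_(k < N) (lam k \*: @bump R d (a k) (w k)).
Proof. by apply/funext => x; rewrite fct_sumE. Qed.

Lemma differentiable_bumps x : differentiable bumps x.
Proof.
rewrite bumps_fun; apply: differentiable_sum => k; apply: differentiableZ.
exact: differentiable_bump.
Qed.

Lemma grad_bumps x i :
  grad bumps x ord0 i = \sum_(k < N) lam k * bump_grad (a k) (w k) x i.
Proof.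
rewrite mxE bumps_fun.
have H := is_derive_sum (fun k => is_deriveZ (lam k) (is_derive_bump (a k) (w k) x (delta_mx 0 i))).
rewrite (@derive_val _ _ _ _ _ _ _ H); apply: eq_bigr => k _; rewrite /GRing.scale/= /bump_grad.
congr (_ * (_ * - (_ * _))); rewrite (bigD1 i)//= big1 ?addr0.
  by rewrite mxE !eqxx mulr1 mulrC.
by move=> j ji; rewrite mxE (negPf ji) andbF mulr0.
Qed.

Let cC (c : R) : continuous (fun _ : 'rV[R]_d => c).
Proof. exact: cst_continuous. Qed.

Let cM (f g : 'rV[R]_d -> R) :
  continuous f -> continuous g -> continuous (fun x => f x * g x).
Proof. by move=> cf cg x; exact: (continuousM (cf x) (cg x)). Qed.

Let cB (f g : 'rV[R]_d -> R) :
  continuous f -> continuous g -> continuous (fun x => f x - g x).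
Proof. by move=> cf cg x; exact: (continuousB (cf x) (cg x)). Qed.

Let continuous_shell b u : continuous (@shell R d b u).
Proof.
have csqn : continuous (@sqn R d).
  by move=> x; exact: differentiable_continuous (differentiable_sqn x).
exact: (cM (cB csqn (@cC (b ^+ 2))) (@cC (b * u)^-1)).
Qed.

Let continuous_bump_grad b u i : continuous (fun x : 'rV[R]_d => bump_grad b u x i).
Proof.
have cs := @continuous_shell b u.
have c1 : continuous (fun x : 'rV[R]_d => 1 - shell b u x ^+ 2) by exact: cB (@cC 1) (cM cs cs).
have cm : continuous (fun x : 'rV[R]_d => Num.max 0 (1 - shell b u x ^+ 2)).
  by move=> x; exact: (continuous_comp (c1 x) (@continuous_maxr0 R _)).
have cN (f : 'rV[R]_d -> R) : continuous f -> continuous (fun x => - f x).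
  by move=> cf x; exact: (continuousN (cf x)).
have cx : continuous (fun x : 'rV[R]_d => x ord0 i) by move=> x; exact: coord_continuous.
exact: (cM (cM (@cC 2) cm) (cN _ (cM (cM (@cC 2) cs) (cM (cM (@cC 2) cx) (@cC (b * u)^-1))))).
Qed.

Lemma continuous_grad_bumps : continuous (grad bumps).
Proof.
apply: continuous_rV => i.
rewrite (_ : (fun x => _) = (fun x => \sum_(k < N) lam k * bump_grad (a k) (w k) x i)); last first.
  by apply/funext => x; rewrite grad_bumps.
elim: (index_enum _) => [|k r IH].
  by under eq_fun do rewrite big_nil; exact: cC.
under eq_fun do rewrite big_cons.
have ck := cM (@cC (lam k)) (@continuous_bump_grad (a k) (w k) i).
by move=> x; exact: (continuousD (ck x) (IH x)).
Qed.

Hypotheses (w0 : forall k, 0 < w k) (wa : forall k, 4 * w k <= a k).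

Let aw0 k : 0 < a k * w k.
Proof. by rewrite mulr_gt0// (lt_le_trans _ (wa k))// mulr_gt0. Qed.

Lemma compactly_supported_bumps : compactly_supported bumps.
Proof.
pose M := \sum_(k < N) 2 * a k.
have a0 k : 0 < a k by rewrite (lt_le_trans _ (wa k))// mulr_gt0.
pose K := [set x : 'rV[R]_d | forall i, `[- M, M]%classic (x ord0 i)].
have cK : compact K.
  by apply: (@rV_compact _ _ (fun=> `[- M, M]%classic)) => i; exact: segment_compact.
apply: (subclosed_compact _ cK); first exact: closed_closure.
have clK : closed K by exact: (@compact_closed _ _ (@norm_hausdorff _ _) cK).
rewrite (iffLR (closure_id K) clK); apply: closureS => x /= gx i /=.
have [k kx] : exists k, bump (a k) (w k) x != 0.
  apply: contrapT => /forallNP H; move: gx; rewrite /bumps big1 ?eqxx// => k _.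
  by have /negP := H k; rewrite negbK => /eqP ->; rewrite mulr0.
rewrite in_itv/= -ler_norml.
apply: (@le_trans _ _ (2 * a k)).
  apply: (@annulus_coord _ _ (a k) (w k)) => //.
  apply: contrapT => nx; move/negP: kx; apply; apply/eqP.
  rewrite /bump /pos_sqr max_l ?mulr0//.
  rewrite subr_le0; move/negP: nx; rewrite -ltNge => nx.
  rewrite -[leRHS]real_normK ?num_real// expr_ge1// /shell normrM [`|_^-1|]gtr0_norm ?invr_gt0//.
  by rewrite ler_pdivlMr// mul1r ltW.
by rewrite /M (bigD1 k)//= lerDl sumr_ge0// => j _; rewrite mulr_ge0// ltW.
Qed.

Lemma C1c_rad_bumps : C1c_rad bumps.
Proof.
split.
- split; [exact: differentiable_bumps|exact: continuous_grad_bumps].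
- exact: compactly_supported_bumps.
- exists (fun r => \sum_(k < N) lam k * pos_sqr (1 - ((r ^+ 2 - a k ^+ 2) / (a k * w k)) ^+ 2)).
  by move=> x; rewrite sqn_enorm.
Qed.

End radial_bumps.

(** * Size, gradient and Lipschitz bounds for one bump *)

Section bump_estimates.
Context {R : realType} (d : nat) (a w : R).
Hypotheses (w0 : 0 < w) (wa : 4 * w <= a).
Implicit Types x y : 'rV[R]_d.

Let a0 : 0 < a. Proof. by rewrite (lt_le_trans _ wa)// mulr_gt0. Qed.
Let aw0 : 0 < a * w. Proof. exact: mulr_gt0. Qed.

Lemma bump_ge0 x : 0 <= bump a w x.
Proof. by rewrite /bump pos_sqrE sqr_ge0. Qed.

Lemma maxr_shell_le1 x : Num.max 0 (1 - shell a w x ^+ 2) <= 1.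
Proof. by rewrite ge_max ler01 gerBl sqr_ge0. Qed.

Lemma maxr_shell_ge0 x : 0 <= Num.max 0 (1 - shell a w x ^+ 2).
Proof. by rewrite le_max lexx. Qed.

Lemma bump_le1 x : bump a w x <= 1.
Proof.
by rewrite /bump pos_sqrE exprn_ile1// ?maxr_shell_le1// maxr_shell_ge0.
Qed.

Lemma annulus_shell x : annulus a w x <-> `|shell a w x| <= 1.
Proof.
by rewrite /annulus/= /shell normrM [`|_^-1|]gtr0_norm ?invr_gt0// ler_pdivrMr// mul1r.
Qed.

Lemma maxr_shell_out x : ~ annulus a w x -> Num.max 0 (1 - shell a w x ^+ 2) = 0.
Proof.
move=> /annulus_shell/negP; rewrite -ltNge => h.
by rewrite max_l// subr_le0 -[leRHS]real_normK ?num_real// expr_ge1// ltW.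
Qed.

Lemma bump_out x : ~ annulus a w x -> bump a w x = 0.
Proof. by move=> /maxr_shell_out h; rewrite /bump pos_sqrE h expr0n. Qed.

(** There the shell variable is at most 1/2 in absolute value, and (1 - 1/4)^2 = 9/16. *)
Lemma bump_ge x : annulus a (w / 2) x -> 2^-1 <= bump a w x.
Proof.
move=> h; have hs : `|shell a w x| <= 2^-1.
  rewrite /shell normrM [`|_^-1|]gtr0_norm ?invr_gt0// ler_pdivrMr//.
  by apply: le_trans h _; rewrite le_eqVlt; apply/orP; left; apply/eqP; ring.
have h4 : shell a w x ^+ 2 <= 4^-1.
  rewrite -real_normK ?num_real//.
  rewrite (_ : 4^-1 = 2^-1 ^+ 2 :> R); last by field.
  by rewrite ler_pXn2r ?nnegrE.
rewrite /bump pos_sqrE max_r; last by lra.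
by nra.
Qed.

Lemma bump_grad_le x i :
  `|bump_grad a w x i| <= 16 / w * \1_(annulus a w) x.
Proof.
have [xS|xS] := pselect (annulus a w x); last first.
  rewrite /bump_grad (maxr_shell_out xS) mulr0 mul0r normr0.
  by apply: mulr_ge0; [rewrite divr_ge0// ltW|rewrite indicE].
rewrite indicE mem_set// mulr1 /bump_grad.
have h1 := maxr_shell_le1 x; have h0 := maxr_shell_ge0 x.
have hs := iffLR (annulus_shell x) xS.
have hx := @annulus_coord _ _ _ _ x i a0 wa xS.
move: (shell a w x) h1 h0 hs => u h1 h0 hs.
rewrite !normrM normrN !normrM [`|Num.max _ _|]ger0_norm// [`|(_ * _)^-1|]gtr0_norm ?invr_gt0//.
rewrite (ger0_norm (x := 2))//.
rewrite (_ : 16 / w = 2 * 1 * (2 * 1 * (2 * (2 * a) / (a * w)))); last first.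
  by field; rewrite ?gt_eqF.
have iaw : 0 <= (a * w)^-1 by rewrite invr_ge0 ltW.
have h3 : 0 <= 2 * `|x ord0 i| / (a * w) by rewrite mulr_ge0// mulr_ge0.
apply: ler_pM; [exact: mulr_ge0|by rewrite mulr_ge0// mulr_ge0|by rewrite ler_wpM2l|].
apply: ler_pM; [exact: mulr_ge0|by []|by rewrite ler_wpM2l|].
by rewrite ler_wpM2r// ler_wpM2l.
Qed.

(** With u and v the positive parts, u^2 - v^2 = (u - v)(u + v) and u + v <= 2, so a Lipschitz
    constant 2 for the positive part of 1 - s^2 is enough. The bound is global although s^2 is not
    Lipschitz, because the profile vanishes for |s| >= 1. *)
Lemma pos_sqr_lipschitz (s t : R) :
  `|pos_sqr (1 - s ^+ 2) - pos_sqr (1 - t ^+ 2)| <= 4 * `|s - t|.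
Proof.
wlog st : s t / Num.max 0 (1 - t ^+ 2) <= Num.max 0 (1 - s ^+ 2).
  move=> H; have /orP[st|st] := le_total (Num.max 0 (1 - t ^+ 2)) (Num.max 0 (1 - s ^+ 2)).
    exact: H.
  by rewrite distrC [`|s - t|]distrC; exact: H.
rewrite !pos_sqrE subr_sqr normrM ger0_norm ?subr_ge0//.
set u := Num.max 0 (1 - s ^+ 2) in st *; set v := Num.max 0 (1 - t ^+ 2) in st *.
have u0 : 0 <= u by rewrite le_max lexx.
have v0 : 0 <= v by rewrite le_max lexx.
have u1 : u <= 1 by rewrite ge_max ler01 gerBl sqr_ge0.
rewrite ger0_norm ?addr_ge0//.
suff H : u - v <= 2 * `|s - t| by have := normr_ge0 (s - t); nra.
have [us|us] := leP u 0.
  by rewrite (@le_trans _ _ 0)// subr_le0 (le_trans us).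
have uE : u = 1 - s ^+ 2 by move: us; rewrite /u lt_max ltxx/= => us; rewrite max_r// ltW.
have s1 : `|s| <= 1.
  by rewrite -(@ler_pXn2r _ 2) ?nnegrE// real_normK ?num_real// expr1n; lra.
have [t1|t1] := leP `|t| 1.
  have vt : 1 - t ^+ 2 <= v by rewrite le_max lexx orbT.
  have : u - v <= (t - s) * (t + s) by rewrite uE; lra.
  move=> /le_trans; apply; apply: (le_trans (ler_norm _)).
  rewrite normrM distrC mulrC ler_wpM2r//.
  by apply: (le_trans (ler_normD _ _)); lra.
(* With t outside [-1, 1], the distance from s to t is at least that from s to the boundary, and u =
   (1 - |s|)(1 + |s|) <= 2 (1 - |s|). *)
have st1 : 1 - `|s| <= `|s - t|.
  have := ler_distD s t 0; rewrite !subr0 distrC; lra.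
apply: (@le_trans _ _ (2 * (1 - `|s|))); last by lra.
rewrite uE -(real_normK (num_real s)); have := normr_ge0 s; nra.
Qed.

Lemma sqn_diff_le x y : (forall i, `|x ord0 i| <= 2 * a) -> (forall i, `|y ord0 i| <= 3 * a) ->
  `|sqn x - sqn y| <= d%:R * (5 * a) * enorm (x - y).
Proof.
move=> xa ya; rewrite /sqn -sumrB; apply: (le_trans (ler_norm_sum _ _ _)).
rewrite -mulrA mulr_natl -[X in _ <= _ *+ X](card_ord d) -sumr_const.
apply: ler_sum => i _; rewrite subr_sqr normrM mulrC; apply: ler_pM => //.
  by apply: (le_trans (ler_normD _ _)); have := xa i; have := ya i; lra.
by have := coord_enorm (x - y) i; rewrite !mxE.
Qed.

(** The minimum joins the trivial bound 1, for |x - y| >= w, to the Lipschitz bound at smaller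
    distances. The constant is 4 from the profile times 5 d from the variation of |x|^2 over a
    region of size [a]. *)
Lemma bump_lipschitz x y :
  `|bump a w x - bump a w y| <=
  20 * d%:R * Num.min 1 (enorm (x - y) / w) * (\1_(annulus a w) x + \1_(annulus a w) y).
Proof.
have [d0|d0] := posnP d.
  have -> : x = y by apply/rowP => i; have := ltn_ord i; rewrite {2}d0.
  by have -> : d%:R = 0 :> R by [rewrite d0]; rewrite subrr normr0 mulr0 !mul0r.
have dd : 1 <= d%:R :> R by rewrite ler1n.
wlog xS : x y / annulus a w x.
  move=> H; have [xS|xS] := pselect (annulus a w x); first exact: H.
  have [yS|yS] := pselect (annulus a w y).
    rewrite distrC [_ + \1__ _]addrC.
    suff -> : enorm (x - y) = enorm (y - x) by exact: H.
    congr Num.sqrt; apply: eq_bigr => i _; rewrite !mxE -[LHS]sqrrN.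
    by rewrite opprB.
  by rewrite !bump_out// subrr normr0 !indicE !memNset// addr0 mulr0.
rewrite -[leLHS]mulr1 ler_pM//; last first.
  by rewrite indicE mem_set// lerDl indicE.
have le1 : `|bump a w x - bump a w y| <= 1.
  have := bump_le1 x; have := bump_le1 y; have := bump_ge0 x; have := bump_ge0 y.
  by rewrite ler_norml; move=> *; apply/andP; split; lra.
have D0 : 1 <= 20 * d%:R :> R by lra.
have e0 := enorm_ge0 (x - y).
have [m1|m1] := leP 1 (enorm (x - y) / w); first by rewrite mulr1 (le_trans le1).
have xa i := @annulus_coord _ _ _ _ x i a0 wa xS.
(* Here |x - y| < w while |x_i| <= 2a. A coordinate of y beyond 3a would give |x - y| >= a >= 4
   w. *)
have [ya|] := pselect (forall i, `|y ord0 i| <= 3 * a).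
  apply: (le_trans (pos_sqr_lipschitz _ _)).
  rewrite /shell -mulrBl opprB addrA subrK normrM [`|_^-1|]gtr0_norm ?invr_gt0//.
  have H := sqn_diff_le xa ya.
  rewrite mulrA ler_pdivrMr//.
  rewrite (_ : _ * (a * w) = 20 * d%:R * enorm (x - y) * a); last by field; rewrite gt_eqF.
  lra.
move=> /existsNP[i /negP]; rewrite -ltNge => yi.
have := coord_enorm (x - y) i; rewrite !mxE => h.
have h2 : a <= enorm (x - y).
  apply: le_trans h; have := xa i.
  by have := ler_distD (x ord0 i) (y ord0 i) 0; rewrite !subr0 distrC; lra.
suff : ~~ (enorm (x - y) / w < 1) by rewrite m1.
by rewrite -leNgt ler_pdivlMr// mul1r; move: w0 wa => *; lra.
Qed.

End bump_estimates.

(** * Product kernels *)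

Section double_integral.
Context d (X : measurableType d) (R : realType).
Variable mu : {sigma_finite_measure set X -> \bar R}.
Local Open Scope ereal_scope.
Implicit Types F G : X -> X -> \bar R.

Lemma measurable_uncurryl F (y : X) : measurable_fun setT (fun z : X * X => F z.1 z.2) ->
  measurable_fun setT (F ^~ y).
Proof.
by move=> mF; exact: (measurableT_comp mF (pair2_measurable y)).
Qed.

Lemma measurable_uncurryr F (x : X) : measurable_fun setT (fun z : X * X => F z.1 z.2) ->
  measurable_fun setT (F x).
Proof.
by move=> mF; exact: (measurableT_comp mF (pair1_measurable x)).
Qed.

Lemma measurable_inner F : measurable_fun setT (fun z : X * X => F z.1 z.2) ->
  (forall x y, 0 <= F x y) -> measurable_fun setT (fun y => \int[mu]_x F x y).
Proof.
move=> mF F0.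
exact: (@measurable_fun_fubini_tonelli_G _ _ _ _ R mu _ mF (fun z => F0 z.1 z.2)).
Qed.

Lemma integral2_sum (I : Type) (r : seq I) (F : I -> X -> X -> \bar R) :
  (forall i, measurable_fun setT (fun z : X * X => F i z.1 z.2)) ->
  (forall i x y, 0 <= F i x y) ->
  \int[mu]_y \int[mu]_x (\sum_(i <- r) F i x y) =
  \sum_(i <- r) \int[mu]_y \int[mu]_x F i x y.
Proof.
move=> mF F0.
under eq_integral => y _.
  rewrite ge0_integral_sum//; last by move=> i; exact: measurable_uncurryl.
  over.
rewrite ge0_integral_sum//; first by move=> i; exact: measurable_inner.
by move=> i y _; apply: integral_ge0 => x _.
Qed.

Lemma integral2Zl F (c : R) : (0 <= c)%R ->
  measurable_fun setT (fun z : X * X => F z.1 z.2) -> (forall x y, 0 <= F x y) ->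
  \int[mu]_y \int[mu]_x (c%:E * F x y) = c%:E * \int[mu]_y \int[mu]_x F x y.
Proof.
move=> c0 mF F0.
under eq_integral => y _.
  rewrite ge0_integralZl//; last exact: (measurable_uncurryl y mF).
  over.
rewrite ge0_integralZl//; first exact: measurable_inner.
by move=> y _; apply: integral_ge0 => x _.
Qed.

Lemma measurable_indic2 G (S T : set X) :
  measurable_fun setT (fun z : X * X => G z.1 z.2) -> measurable S -> measurable T ->
  measurable_fun setT (fun z : X * X => (\1_S z.2)%:E * ((\1_T z.1)%:E * G z.1 z.2)).
Proof.
move=> mG mS mT; apply: emeasurable_funM.
  apply/measurable_EFinP.
  exact: (measurableT_comp (measurable_indic mS) measurable_snd).
apply: emeasurable_funM => //.
apply/measurable_EFinP.
exact: (measurableT_comp (measurable_indic mT) measurable_fst).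
Qed.

Variables (G : X -> X -> \bar R) (S T : set X) (B : \bar R).
Hypotheses (mG : measurable_fun setT (fun z : X * X => G z.1 z.2))
  (G0 : forall x y, 0 <= G x y) (mS : measurable S) (mT : measurable T) (B0 : 0 <= B).

Let mF : measurable_fun setT
  (fun z : X * X => (\1_S z.2)%:E * ((\1_T z.1)%:E * G z.1 z.2)).
Proof. exact: measurable_indic2. Qed.

Let F0 x y : 0 <= (\1_S y)%:E * ((\1_T x)%:E * G x y).
Proof. by rewrite !mule_ge0// lee_fin. Qed.

Lemma integral2_le_inner : (forall y, \int[mu]_x ((\1_T x)%:E * G x y) <= B) ->
  \int[mu]_y \int[mu]_x ((\1_S y)%:E * ((\1_T x)%:E * G x y)) <= B * mu S.
Proof.
move=> HB.
have mTG y : measurable_fun setT (fun x => (\1_T x)%:E * G x y).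
  apply: emeasurable_funM; last exact: measurable_uncurryl.
  by apply/measurable_EFinP; exact: measurable_indic.
apply: (@le_trans _ _ (\int[mu]_y (B * (\1_S y)%:E))).
  apply: le_integral_ge0 => y; first by apply: integral_ge0 => x _; exact: F0.
  rewrite ge0_integralZl//; last by move=> x _; rewrite mule_ge0// lee_fin.
  by rewrite muleC; apply: lee_wpmul2r; rewrite ?lee_fin.
rewrite ge0_integralZl ?integral_indic ?setIT//.
by apply/measurable_EFinP; exact: measurable_indic.
Qed.

(** Tonelli exchanges the order, for use when the uniform bound is on the integral in y. *)
Lemma integral2_le_outer : (forall x, \int[mu]_y ((\1_S y)%:E * G x y) <= B) ->
  \int[mu]_y \int[mu]_x ((\1_S y)%:E * ((\1_T x)%:E * G x y)) <= B * mu T.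
Proof.
move=> HB.
have mSG x : measurable_fun setT (fun y => (\1_S y)%:E * G x y).
  apply: emeasurable_funM; last exact: measurable_uncurryr.
  by apply/measurable_EFinP; exact: measurable_indic.
have := @fubini_tonelli _ _ _ _ R mu mu _ mF (fun z => F0 z.1 z.2) => /= <-.
apply: (@le_trans _ _ (\int[mu]_y (B * (\1_T y)%:E))).
  apply: le_integral_ge0 => x; first by apply: integral_ge0 => y _; exact: F0.
  under eq_integral do rewrite muleCA.
  rewrite ge0_integralZl//; last by move=> y _; rewrite mule_ge0// lee_fin.
  by rewrite muleC; apply: lee_wpmul2r; rewrite ?lee_fin.
rewrite ge0_integralZl ?integral_indic ?setIT//.
by apply/measurable_EFinP; exact: measurable_indic.
Qed.

End double_integral.

Section product_kernel.
Context {R : realType}.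
Local Notation mR := (measurableTypeR R).
Variables (h : mR -> \bar R) (c : R).
Hypotheses (mh : measurable_fun setT h) (h0 : forall v, (0 <= h v)%E)
  (hN : forall v, h (- v) = h v) (c0 : 0 <= c)
  (hint : forall x r : R, 0 < r ->
    (\int[lebesgue_measure]_(t in [set: mR]) h ((t - x) / r)%R <= (c * r)%:E)%E).

(** The predicate allows one coordinate to be left out, namely the one in which an annulus piece is
    sliced. *)
Definition prod_kernel d (P : pred 'I_d) (r : R) (x y : 'rV[R]_d) : \bar R :=
  (\prod_(j < d | P j) h ((x ord0 j - y ord0 j) / r)%R)%E.

Lemma prod_kernel_ge0 d P r (x y : 'rV[R]_d) : (0 <= prod_kernel P r x y)%E.
Proof. exact: prode_ge0. Qed.

Lemma prod_kernelC d P r (x y : 'rV[R]_d) : prod_kernel P r x y = prod_kernel P r y x.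
Proof. by apply: eq_bigr => j _; rewrite -hN -mulNr opprB. Qed.

Lemma measurable_prod_kernel d P r :
  measurable_fun setT (fun z : 'rV[R]_d * 'rV[R]_d => prod_kernel P r z.1 z.2).
Proof.
apply: (@emeasurable_prod _ _ _ _ _ _
  (fun j (z : 'rV[R]_d * 'rV[R]_d) => h ((z.1 ord0 j - z.2 ord0 j) / r))) => j.
apply: (measurableT_comp mh); apply: measurable_funM => //.
apply: measurable_funB.
  exact: (measurableT_comp (@measurable_rV_coord R d j) measurable_fst).
exact: (measurableT_comp (@measurable_rV_coord R d j) measurable_snd).
Qed.

Let mh_affine (x r : R) : measurable_fun setT (fun t : mR => h ((t - x) / r)).
Proof.
apply: (measurableT_comp mh); apply: measurable_funM => //.
exact: measurable_funB.
Qed.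

Lemma integral_prod_kernel_le d r (y : 'rV[R]_d) : 0 < r ->
  (\int[lebesgue_rV d]_x prod_kernel xpredT r x y <= ((c * r) ^+ d)%:E)%E.
Proof.
move=> r0.
rewrite (@integral_tensor _ _ (fun j (t : mR) => h ((t - y ord0 j) / r)))//.
rewrite -[X in (_ ^+ X)](card_ord d).
apply: eprod_le_cst => j; first exact: integral_ge0.
exact: hint.
Qed.

(** The slice gives the factor [w] and each of the other d - 1 coordinates integrates to at most c
    a. The bound is uniform in [y], even for [y] inside the piece, since the singularity is already
    integrable in d - 1 variables. *)
Lemma integral_piece_kernel_le d (i : 'I_d) (a w : R) (y : 'rV[R]_d) : 0 < a -> 0 < w ->
  (\int[lebesgue_rV d]_x
     ((\1_(annulus_piece i a w) x)%:E * prod_kernel (predC1 i) a x y) <=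
   (8 * d%:R * w * (c * a) ^+ d.-1)%:E)%E.
Proof.
move=> a0 w0.
apply: (le_trans (@integral_slice _ _ i (fun j (t : mR) => h ((t - y ord0 j) / a))
  _ (8 * d%:R * w)%:E _ _ _ _ _)) => //.
- by rewrite lee_fin mulr_ge0// ltW.
- exact: measurable_annulus_piece.
- by move=> x; exact: annulus_piece_slice.
rewrite [leRHS]EFinM; apply: lee_wpmul2l; first by rewrite lee_fin mulr_ge0// ltW.
rewrite (_ : d.-1 = #|predC1 i|); last by rewrite cardC1 card_ord.
apply: eprod_le_cst => j; first exact: integral_ge0.
exact: hint.
Qed.

End product_kernel.

(** * Pointwise estimates *)

Section pointwise.
Context {R : realType}.
Local Notation mR := (measurableTypeR R).

Lemma enorm_le d (x : 'rV[R]_d) (M : R) : 0 <= M ->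
  (forall i, `|x ord0 i| <= M) -> enorm x <= d%:R * M.
Proof.
move=> M0 xM; rewrite -(@ler_pXn2r _ 2) ?nnegrE ?enorm_ge0 ?mulr_ge0// sqn_enorm.
apply: (@le_trans _ _ (\sum_(i < d) M ^+ 2)).
  apply: ler_sum => i _; rewrite -[leLHS]real_normK ?num_real//.
  by rewrite ler_pXn2r ?nnegrE.
rewrite sumr_const card_ord -[_ *+ _]mulr_natl exprMn ler_wpM2r ?sqr_ge0//.
by case: d x xM => [|d] x xM; rewrite ?expr0n// expr2 ler_peMr// ler1n.
Qed.

Variables (h : mR -> \bar R) (eps : R).
Hypotheses (h0 : forall v, (0 <= h v)%E)
  (hge : forall rho v : R, 0 < rho -> `|v| <= rho ->
      ((Num.min (rho `^ (eps - 1)) (rho `^ (- 1 - eps)))%:E <= h v)%E).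

(** Each |x_j - y_j| is at most |x - y|, and [hge] holds for every rho above |v|: all factors may be
    bounded by the profile at the same point |x - y| / r. *)
Lemma prod_kernel_ge d (P : pred 'I_d) (r : R) (x y : 'rV[R]_d) :
  0 < r -> 0 < enorm (x - y) ->
  (((Num.min ((enorm (x - y) / r) `^ (eps - 1)) ((enorm (x - y) / r) `^ (- 1 - eps)))
     ^+ #|P|)%:E <= prod_kernel h P r x y)%E.
Proof.
move=> r0 xy0; rewrite -prodr_const (big_morph EFin (@EFinM R) erefl).
apply: le_eprod => j _; first by rewrite lee_fin le_min !powR_ge0.
apply: hge; first exact: divr_gt0.
rewrite normrM [`|_^-1|]gtr0_norm ?invr_gt0// ler_wpM2r ?invr_ge0 ?(ltW r0)//.
by have := coord_enorm (x - y) j; rewrite !mxE.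
Qed.

Hypothesis eps0 : 0 < eps.

Let powRX (v e : R) n : (v `^ e) ^+ n = v `^ (e * n%:R).
Proof. by rewrite powRrM powR_mulrn// powR_ge0. Qed.

(** In v = |x - y| / r the left side is v^(p - sp - d) near 0 and v^(-sp - d) at infinity, up to the
    power of r, while d factors of the profile give v^(d eps - d) and v^(-d - d eps). The two
    conditions on [eps] compare these exponents. *)
Lemma gagliardo_kernel_le d (s p r : R) (x y : 'rV[R]_d) :
  0 < d%:R + s * p -> 0 <= p -> d%:R * eps <= s * p -> d%:R * eps <= p - s * p -> 0 < r ->
  ((Num.min 1 (enorm (x - y) / r) `^ p / enorm (x - y) `^ (d%:R + s * p))%:E <=
   (r `^ (- (d%:R + s * p)))%:E * prod_kernel h xpredT r x y)%E.
Proof.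
move=> ds0 p0 e1 e2 r0.
have [xy0|xy0] := ltP 0 (enorm (x - y)); last first.
  have -> : enorm (x - y) = 0 by apply/eqP; rewrite eq_le xy0 enorm_ge0.
  rewrite powR0 ?gt_eqF// invr0 mulr0 mule_ge0 ?prod_kernel_ge0//.
  by rewrite lee_fin powR_ge0.
have := @prod_kernel_ge d xpredT r x y r0 xy0.
rewrite [X in _ ^+ X](_ : _ = d); last by rewrite -[RHS](card_ord d); exact: eq_card.
set v := enorm (x - y) / r => H.
have v0 : 0 < v by exact: divr_gt0.
apply: (@le_trans _ _ ((r `^ (- (d%:R + s * p)))%:E *
    ((Num.min (v `^ (eps - 1)) (v `^ (- 1 - eps))) ^+ d)%:E)%E); last first.
  by apply: lee_wpmul2l => //; rewrite lee_fin powR_ge0.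
rewrite -EFinM lee_fin.
have -> : enorm (x - y) = v * r by rewrite mulfVK// gt_eqF.
rewrite powRM ?(ltW v0) ?(ltW r0)// invfM -!powRN mulrA mulrC ler_wpM2l ?powR_ge0//.
have [v1|v1] := leP v 1.
  rewrite -powRD; last by rewrite (gt_eqF v0) implybT.
  (* Stated for all such [e], this covers both candidates of the minimum, as -1 - eps <= eps - 1. *)
  have K e : e <= eps - 1 -> v `^ (p + - (d%:R + s * p)) <= (v `^ e) ^+ d.
    move=> e_le; rewrite powRX; apply: ger_powR; first by rewrite v0.
    have : e * d%:R <= (eps - 1) * d%:R by rewrite ler_wpM2r.
    lra.
  by case: (leP (v `^ (eps - 1)) _) => _; apply: K; move: eps0 => ?; lra.
rewrite powR1 mul1r.
have K e : - 1 - eps <= e -> v `^ (- (d%:R + s * p)) <= (v `^ e) ^+ d.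
  move=> e_ge; rewrite powRX; apply: ler_powR; first exact: ltW.
  have : (- 1 - eps) * d%:R <= e * d%:R by rewrite ler_wpM2r.
  lra.
by case: (leP (v `^ (eps - 1)) _) => _; apply: K; move: eps0 => ?; lra.
Qed.

(** By the choice of [b], v^-b is exactly the power d - 1 of v^(eps - 1). For large v the profile is
    smaller by v^(-2 eps), a loss that is bounded because v <= V; this gives the power of [V]. *)
Lemma coulomb_kernel_le d (i : 'I_d) (b V a : R) (x y : 'rV[R]_d) :
  0 < b -> b = (1 - eps) * d.-1%:R -> 1 <= V -> 0 < a ->
  enorm (x - y) <= V * a ->
  (((enorm (x - y) `^ b)^-1)%:E <=
   (V `^ (2 * eps * d.-1%:R) * a `^ (- b))%:E * prod_kernel h (predC1 i) a x y)%E.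
Proof.
move=> b0 bE V1 a0 xyV.
have [xy0|xy0] := ltP 0 (enorm (x - y)); last first.
  have -> : enorm (x - y) = 0 by apply/eqP; rewrite eq_le xy0 enorm_ge0.
  rewrite powR0 ?gt_eqF// invr0 mule_ge0 ?prod_kernel_ge0//.
  by rewrite lee_fin mulr_ge0// powR_ge0.
have := @prod_kernel_ge d (predC1 i) a x y a0 xy0.
rewrite cardC1 card_ord.
set v := enorm (x - y) / a => H.
have v0 : 0 < v by exact: divr_gt0.
apply: (@le_trans _ _ ((V `^ (2 * eps * d.-1%:R) * a `^ (- b))%:E *
    ((Num.min (v `^ (eps - 1)) (v `^ (- 1 - eps))) ^+ d.-1)%:E)%E); last first.
  by apply: lee_wpmul2l => //; rewrite lee_fin mulr_ge0// powR_ge0.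
rewrite -EFinM lee_fin.
have -> : enorm (x - y) = v * a by rewrite mulfVK// gt_eqF.
rewrite powRM ?(ltW v0) ?(ltW a0)// invfM -!powRN mulrAC ler_wpM2r ?powR_ge0//.
have vV : v <= V by rewrite ler_pdivrMr.
have V0 : 0 < V by exact: lt_le_trans V1.
have e0 : 0 <= 2 * eps * d.-1%:R by rewrite !mulr_ge0// ltW.
case: (leP (v `^ (eps - 1)) _) => _; rewrite powRX.
  rewrite bE (_ : - ((1 - eps) * d.-1%:R) = (eps - 1) * d.-1%:R); last by ring.
  rewrite ler_peMl ?powR_ge0//.
  have := @powR_le_base R 1 V (2 * eps * d.-1%:R).
  by rewrite powR1; apply.
rewrite (_ : - b = (2 * eps * d.-1%:R) + (- 1 - eps) * d.-1%:R); last by rewrite bE; ring.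
rewrite powRD; last by rewrite (gt_eqF v0) implybT.
rewrite ler_wpM2r ?powR_ge0//.
by apply: powR_le_base => //; exact: ltW.
Qed.

End pointwise.

(** * Superpositions of bumps with disjoint supports *)

Section disjoint_annuli.
Context {R : realType} (d N : nat) (lam a w : 'I_N -> R).
Hypotheses (lam0 : forall k, 0 <= lam k) (w0 : forall k, 0 < w k)
  (wa : forall k, 4 * w k <= a k)
  (disj : forall (x : 'rV[R]_d) j k,
    annulus (a j) (w j) x -> annulus (a k) (w k) x -> j = k).
Implicit Types x y : 'rV[R]_d.
Local Notation S k := (@annulus R d (a k) (w k)).
Local Notation g := (@bumps R d N lam a w).

Let a0 k : 0 < a k. Proof. by rewrite (lt_le_trans _ (wa k))// mulr_gt0. Qed.

Lemma sum_disjoint (V : nmodType) (F : 'I_N -> V) x j :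
  S j x -> (forall k, ~ S k x -> F k = 0) -> \sum_k F k = F j.
Proof.
move=> xj F0; rewrite (bigD1 j)//= big1 ?addr0// => k kj; apply: F0 => xk.
by move: kj; rewrite (disj xj xk) eqxx.
Qed.

Lemma bumps_in x j : S j x -> g x = lam j * bump (a j) (w j) x.
Proof.
move=> xj; rewrite /bumps (sum_disjoint (F := fun k => lam k * bump (a k) (w k) x) xj)//.
by move=> k xk; rewrite bump_out// mulr0.
Qed.

Lemma bumps_out x : (forall k, ~ S k x) -> g x = 0.
Proof.
by move=> xS; rewrite /bumps big1// => k _; rewrite bump_out// mulr0.
Qed.

Lemma bumps_ge x k : lam k * bump (a k) (w k) x <= g x.
Proof.
rewrite /bumps (bigD1 k)//= lerDl sumr_ge0// => j _.
by rewrite mulr_ge0// bump_ge0.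
Qed.

Lemma bumps_ge0 x : 0 <= g x.
Proof. by apply: sumr_ge0 => j _; rewrite mulr_ge0// bump_ge0. Qed.

Lemma bumps_powR_le x (q : R) : 0 < q ->
  `|g x| `^ q <= \sum_k lam k `^ q * \1_(S k) x.
Proof.
move=> q0; rewrite ger0_norm ?bumps_ge0//.
have [[j xj]|/forallNP nx] := pselect (exists j, S j x); last first.
  rewrite bumps_out// powR0 ?gt_eqF// sumr_ge0// => k _.
  by rewrite mulr_ge0 ?powR_ge0// indicE.
rewrite (bumps_in xj) (bigD1 j)//= [X in _ * X + _]indicE mem_set// mulr1.
apply: (@le_trans _ _ (lam j `^ q)).
  apply: powR_le_base; [by rewrite mulr_ge0// bump_ge0| |exact: ltW].
  by rewrite ler_piMr// bump_le1.
by rewrite lerDl sumr_ge0// => k _; rewrite mulr_ge0 ?powR_ge0// indicE.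
Qed.

Lemma bumps_powR_ge x (q : R) : 0 < q ->
  \sum_k (lam k / 2) `^ q * \1_(annulus (a k) (w k / 2)) x <= `|g x| `^ q.
Proof.
move=> q0; rewrite ger0_norm ?bumps_ge0//.
have sub k : annulus (a k) (w k / 2) x -> S k x.
  rewrite /annulus/= => /le_trans; apply; rewrite ler_wpM2l ?(ltW (a0 k))//.
  by rewrite ler_pdivrMr// ler_peMr ?(ltW (w0 k))// ler1n.
have [[j xj]|/forallNP nx] := pselect (exists j, annulus (a j) (w j / 2) x); last first.
  rewrite big1 ?powR_ge0// => k _.
  by rewrite indicE memNset ?mulr0.
rewrite (sum_disjoint (F := fun k => (lam k / 2) `^ q * \1_(annulus (a k) (w k / 2)) x) (sub _ xj)).
  rewrite indicE mem_set// mulr1.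
  apply: powR_le_base; [by rewrite divr_ge0| |exact: ltW].
  apply: le_trans (bumps_ge x j); rewrite ler_wpM2l//.
  exact: bump_ge.
by move=> k xk; rewrite indicE memNset ?mulr0// => /sub.
Qed.

(* If g y <= g x then x lies in a single annulus j and g y >= g_j y, so that
   the increment of g is at most that of g_j: no interaction terms appear. *)
Lemma bumps_diff_le x y (p : R) : 0 < p ->
  `|g x - g y| `^ p <= \sum_k (lam k * `|bump (a k) (w k) x - bump (a k) (w k) y|) `^ p.
Proof.
move=> p0; wlog gxy : x y / g y <= g x.
  move=> H; have /orP[|gxy] := le_total (g y) (g x); first exact: H.
  rewrite distrC; apply: (le_trans (H _ _ gxy)).
  by apply: ler_sum => k _; rewrite distrC.
rewrite ger0_norm ?subr_ge0//.
have [[j xj]|/forallNP nx] := pselect (exists j, S j x); last first.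
  have gx := bumps_out nx.
  have -> : g x - g y = 0.
    by apply/eqP; rewrite subr_eq0 eq_le gxy gx bumps_ge0.
  by rewrite powR0 ?gt_eqF// sumr_ge0// => k _; rewrite powR_ge0.
rewrite (bigD1 j)//=.
apply: (@le_trans _ _ ((lam j * `|bump (a j) (w j) x - bump (a j) (w j) y|) `^ p)); last first.
  by rewrite lerDl sumr_ge0// => k _; rewrite powR_ge0.
apply: powR_le_base; [by rewrite subr_ge0| |exact: ltW].
apply: (@le_trans _ _ (lam j * (bump (a j) (w j) x - bump (a j) (w j) y))).
  by rewrite mulrBr -(bumps_in xj) lerB// bumps_ge.
by rewrite ler_wpM2l// ler_norm.
Qed.

Lemma grad_bumps_powR_le x (p : R) : 0 < p ->
  enorm (grad g x) `^ p <= \sum_k (16 * d%:R * lam k / w k) `^ p * \1_(S k) x.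
Proof.
move=> p0.
have [[j xj]|/forallNP nx] := pselect (exists j, S j x); last first.
  have -> : enorm (grad g x) = 0.
    apply/eqP; rewrite eq_le enorm_ge0 andbT.
    apply: (le_trans (@enorm_le _ _ _ 0 _ _)); rewrite ?mulr0// => i.
    rewrite grad_bumps big1 ?normr0// => k _.
    by rewrite /bump_grad maxr_shell_out// mulr0 mul0r mulr0.
  rewrite powR0 ?gt_eqF// sumr_ge0// => k _.
  by rewrite mulr_ge0 ?powR_ge0// indicE.
rewrite (bigD1 j)//= [X in _ * X + _]indicE mem_set// mulr1.
apply: (@le_trans _ _ ((16 * d%:R * lam j / w j) `^ p)); last first.
  by rewrite lerDl sumr_ge0// => k _; rewrite mulr_ge0 ?powR_ge0// indicE.
apply: powR_le_base; [exact: enorm_ge0| |exact: ltW].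
rewrite (_ : 16 * d%:R * lam j / w j = d%:R * (lam j * (16 / w j))); last by ring.
have w16 : 0 <= 16 / w j by rewrite divr_ge0// ltW.
apply: enorm_le => [|i]; first by rewrite mulr_ge0.
rewrite grad_bumps (sum_disjoint (F := fun k => lam k * bump_grad (a k) (w k) x i) xj).
  rewrite normrM ger0_norm// ler_wpM2l//.
  apply: (le_trans (bump_grad_le (w0 j) (wa j) x i)).
  by rewrite indicE mem_set// mulr1.
by move=> k xk; rewrite /bump_grad maxr_shell_out// mulr0 mul0r mulr0.
Qed.

End disjoint_annuli.

(** * Bounds for the functionals *)

Definition separated_annuli (R : realType) (d N : nat) (a w : 'I_N -> R) :=
  [/\ forall k, 0 < w k, forall k, 4 * w k <= a k &
      forall (x : 'rV[R]_d) j k,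
        annulus (a j) (w j) x -> annulus (a k) (w k) x -> j = k].

Section energies.
Context {R : realType} (n : nat).
Local Notation D := n.+1.

(** The product kernel is taken at scale w_k, where the Lipschitz bound saturates. Its integral over
    the whole space is at most (c w)^d and the other point ranges over a set of volume a^(d-1) w;
    with the prefactor w^(-d - sp) this gives a^(d-1) w^(1 - sp). *)
Lemma gagliardo_bumps_le (s p : R) : 0 < s -> s < 1 -> 1 <= p ->
  exists2 C : R, 0 < C & forall N (lam a w : 'I_N -> R),
    (forall k, 0 <= lam k) -> separated_annuli D a w ->
    (\int[lebesgue_rV D]_y \int[lebesgue_rV D]_x
       (`|bumps lam a w x - bumps lam a w y| `^ p /
        enorm (x - y) `^ (D%:R + s * p))%:E <=
     (C * \sum_k lam k `^ p * (a k ^+ n * w k `^ (1 - s * p)))%:E)%E.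
Proof.
move=> s0 s1 p1; have p0 : 0 < p by exact: lt_le_trans p1.
have D0 : 1 <= D%:R :> R by rewrite ler1n.
(* Small enough for decay at infinity (s p > 0) and for integrability on the diagonal ((1 - s) p >
   0). *)
pose eps := Num.min 1 (Num.min (s * p / D%:R) ((1 - s) * p / D%:R)).
have sp0 : 0 < s * p by rewrite mulr_gt0.
have eps0 : 0 < eps.
  by rewrite !lt_min ltr01 !divr_gt0// mulr_gt0// subr_gt0.
have eps1 : eps <= 1 by rewrite ge_min lexx.
have e1 : D%:R * eps <= s * p.
  by rewrite mulrC -ler_pdivlMr// !ge_min lexx orbT.
have e2 : D%:R * eps <= p - s * p.
  by rewrite mulrC -ler_pdivlMr// -{1}[p]mul1r -mulrBl !ge_min lexx !orbT.
have [h [c [mh h0 hN hge [c0 hint]]]] := kernel_majorant eps0 eps1.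
have [Cv Cv0 vol] := @annulus_volume_le R n.
(* 20 comes from [bump_lipschitz], doubled by the p-th power of a sum of two indicators; the outer 2
   counts which of x, y lies in the annulus. Adding 1 makes the constant positive, as [c] is only
   nonnegative. *)
exists (2 * ((40 * D%:R) `^ p * c ^+ D * Cv) + 1).
  by rewrite ltr_pwDr// mulr_ge0// !mulr_ge0 ?powR_ge0 ?exprn_ge0// ltW.
move=> N lam a w lam0 [w0 wa disj].
have E0 : 0 < D%:R + s * p by rewrite addr_gt0.
pose H k (x y : 'rV[R]_D) := prod_kernel h xpredT (w k) x y.
pose S k : set 'rV[R]_D := annulus (a k) (w k).
have mS k : measurable (S k) by exact: measurable_annulus.
have mH k : measurable_fun setT (fun z : 'rV[R]_D * 'rV[R]_D => H k z.1 z.2).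
  exact: measurable_prod_kernel.
pose K k := (40 * D%:R * lam k) `^ p * w k `^ (- (D%:R + s * p)).
have K0 k : 0 <= K k by rewrite mulr_ge0// powR_ge0.
(* The boolean tells which point is confined to the annulus: y if true, x if false. *)
pose A (t : 'I_N * bool) := if t.2 then S t.1 else setT.
pose B (t : 'I_N * bool) := if t.2 then setT else S t.1.
have mA t : measurable (A t) by rewrite /A; case: ifP.
have mB t : measurable (B t) by rewrite /B; case: ifP.
pose F (t : 'I_N * bool) x y : \bar R :=
  ((K t.1)%:E * ((\1_(A t) y)%:E * ((\1_(B t) x)%:E * H t.1 x y)))%E.
have F0 t x y : (0 <= F t x y)%E.
  by rewrite !mule_ge0 ?lee_fin//; exact: prode_ge0.
have mG t : measurable_fun setT (fun z : 'rV[R]_D * 'rV[R]_D =>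
    ((\1_(A t) z.2)%:E * ((\1_(B t) z.1)%:E * H t.1 z.1 z.2))%E).
  exact: (measurable_indic2 (G := H t.1)).
have mF t : measurable_fun setT (fun z : 'rV[R]_D * 'rV[R]_D => F t z.1 z.2).
  exact: emeasurable_funM.
apply: (@le_trans _ _ (\int[lebesgue_rV D]_y \int[lebesgue_rV D]_x
   \sum_(t : 'I_N * bool) F t x y)%E).
  apply: le_integral_ge0 => y.
    by apply: integral_ge0 => x _; rewrite lee_fin divr_ge0 ?powR_ge0.
  apply: le_integral_ge0 => x; first by rewrite lee_fin divr_ge0 ?powR_ge0.
  set rho := enorm (x - y); set E := D%:R + s * p.
  apply: (@le_trans _ _ (\sum_k ((40 * D%:R * lam k) `^ p * (\1_(S k) x + \1_(S k) y) *
      (Num.min 1 (rho / w k) `^ p / rho `^ E))%:E)%E).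
    rewrite sumEFin lee_fin.
    apply: (le_trans (ler_wpM2r _ (bumps_diff_le lam0 w0 wa disj x y p0))).
      by rewrite invr_ge0 powR_ge0.
    rewrite mulr_suml; apply: ler_sum => k _.
    rewrite mulrA ler_wpM2r ?invr_ge0 ?powR_ge0//.
    have L := bump_lipschitz (w0 k) (wa k) x y.
    set m := Num.min 1 (rho / w k) in L *.
    have m0 : 0 <= m by rewrite le_min ler01 divr_ge0 ?enorm_ge0// ltW.
    set i := \1_(S k) x + \1_(S k) y.
    have i0 : 0 <= i by rewrite addr_ge0// indicE.
    apply: (@le_trans _ _ ((lam k * (20 * D%:R * m * i)) `^ p)).
      apply: powR_le_base; [by rewrite mulr_ge0| |exact: ltW].
      by rewrite ler_wpM2l.
    have one : 1 `^ p = 1 by rewrite powR1.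
    have i2 : i `^ p <= 2 `^ p * i.
      rewrite /i !indicE -natrD; case: (x \in S k); case: (y \in S k).
      - rewrite (_ : (true + true)%N = 2)// ler_peMr ?powR_ge0// ler1n//.
      - rewrite (_ : (true + false)%N = 1)// powR1 mulr1 -[leLHS]one.
        by apply: powR_le_base => //; [rewrite ler1n|exact: ltW].
      - rewrite (_ : (false + true)%N = 1)// powR1 mulr1 -[leLHS]one.
        by apply: powR_le_base => //; [rewrite ler1n|exact: ltW].
      - by rewrite (_ : (false + false)%N = 0)// powR0 ?gt_eqF// mulr0.
    rewrite (_ : lam k * (20 * D%:R * m * i) = (20 * D%:R * lam k) * m * i); last by ring.
    rewrite (_ : 40 * D%:R * lam k = 2 * (20 * D%:R * lam k)); last by ring.
    have l0 : 0 <= 20 * D%:R * lam k by rewrite mulr_ge0.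
    rewrite (powRM _ _ i0); last by rewrite mulr_ge0.
    rewrite (powRM _ l0 m0) (powRM _ _ l0)//.
    rewrite [leRHS](_ : _ = (20 * D%:R * lam k) `^ p * m `^ p * (2 `^ p * i)); last by ring.
    by rewrite ler_wpM2l// mulr_ge0// powR_ge0.
  rewrite -(pair_bigA _ (fun k b => F (k, b) x y))/=.
  apply: lee_sum => k _; rewrite big_bool /F/A/B/S/=.
  have := @gagliardo_kernel_le R h eps h0 hge eps0 D s p (w k) x y E0 (ltW p0) e1 e2 (w0 k).
  rewrite -/rho -/E => G.
  rewrite EFinM.
  apply: (le_trans (lee_wpmul2l _ G)).
    by rewrite lee_fin mulr_ge0 ?powR_ge0// addr_ge0// indicE.
  rewrite -/(H k x y) /K !EFinM EFinD !indicE !mem_setT/= !mul1e.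
  have H0 : (0 <= H k x y)%E by exact: prode_ge0.
  case: (x \in _); case: (y \in _) => /=; rewrite ?mul1e ?mul0e ?mule0 ?adde0 ?add0e.
  - by rewrite muleDr// ?mule1 ge0_muleDl ?muleA// lee_fin powR_ge0.
  - by rewrite mule1 muleA.
  - by rewrite mule1 muleA.
  - by rewrite mule0 mul0e.
rewrite (@integral2_sum _ _ _ (lebesgue_rV D) _ _ F)//.
apply: (@le_trans _ _ (\sum_(t : 'I_N * bool)
    (K t.1 * ((c * w t.1) ^+ D * (Cv * (a t.1 ^+ n * w t.1))))%:E)%E).
  apply: lee_sum => t _.
  rewrite (@integral2Zl _ _ _ (lebesgue_rV D))//; last first.
    by move=> x y; rewrite !mule_ge0 ?lee_fin//; exact: prode_ge0.
  rewrite [leRHS]EFinM; apply: lee_wpmul2l; first by rewrite lee_fin.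
  rewrite [leRHS]EFinM.
  have cw0 : 0 <= (c * w t.1) ^+ D by rewrite exprn_ge0// mulr_ge0// ltW.
  apply: (@le_trans _ _ (((c * w t.1) ^+ D)%:E * lebesgue_rV D (S t.1))%E); last first.
    by apply: lee_wpmul2l; [rewrite lee_fin|exact: vol].
  have int1 y : (\int[lebesgue_rV D]_x H t.1 x y <= ((c * w t.1) ^+ D)%:E)%E.
    exact: integral_prod_kernel_le.
  (* The unconfined variable is integrated first, over the whole space. *)
  rewrite /A /B; case: (t.2).
    apply: integral2_le_inner => //; [by move=> x y; exact: prode_ge0|].
    by move=> y; under eq_integral do rewrite indicE mem_setT mul1e.
  apply: integral2_le_outer => //; [by move=> x y; exact: prode_ge0|].
  move=> x; under eq_integral do rewrite indicE mem_setT mul1e /H prod_kernelC//.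
  exact: int1.
rewrite sumEFin lee_fin.
rewrite -(pair_bigA _ (fun k (b : bool) => K k * ((c * w k) ^+ D * (Cv * (a k ^+ n * w k)))))/=.
under eq_bigr do rewrite big_bool/=.
rewrite mulrDl mul1r.
apply: (@le_trans _ _ (2 * ((40 * D%:R) `^ p * c ^+ D * Cv) *
    \sum_k lam k `^ p * (a k ^+ n * w k `^ (1 - s * p)))); last first.
  rewrite lerDl sumr_ge0// => k _.
  rewrite !mulr_ge0 ?powR_ge0 ?exprn_ge0// (le_trans _ (wa k))// mulr_ge0// ltW//.
rewrite mulr_sumr le_eqVlt; apply/orP; left; apply/eqP; apply: eq_bigr => k _.
rewrite /K powRM ?mulr_ge0// exprMn.
have -> : w k `^ (1 - s * p) = w k `^ (- (D%:R + s * p)) * (w k ^+ D * w k).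
  have wk (x : R) : (x == 0) ==> (w k != 0) by rewrite (gt_eqF (w0 k)) implybT.
  have -> : w k ^+ D * w k = w k `^ (D%:R + 1).
    have w0k := ltW (w0 k).
    have P : w k `^ D%:R = w k ^+ D by exact: powR_mulrn.
    by rewrite (powRD (wk _)) P powRr1.
  by rewrite -(powRD (wk _)); congr powR; ring.
by ring.
Qed.

End energies.

Section energies_local.
Context {R : realType} (n : nat).
Local Notation D := n.+1.

Lemma integral_sum_indic d (X : measurableType d) (mu : {measure set X -> \bar R}) N
    (c : 'I_N -> R) (S : 'I_N -> set X) :
  (forall k, 0 <= c k) -> (forall k, measurable (S k)) ->
  (\int[mu]_x (\sum_k c k * \1_(S k) x)%:E = \sum_k (c k)%:E * mu (S k))%E.
Proof.
move=> c0 mS.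
have mI k : measurable_fun setT (fun x => (\1_(S k) x)%:E : \bar R).
  by apply/measurable_EFinP; exact: measurable_indic.
under eq_integral => x _.
  rewrite -sumEFin; under eq_bigr do rewrite EFinM.
  over.
rewrite ge0_integral_sum//.
- by apply: eq_bigr => k _; rewrite ge0_integralZl ?integral_indic ?setIT// lee_fin.
- by move=> k; exact: emeasurable_funM.
- by move=> k x _; rewrite mule_ge0// lee_fin.
Qed.

Lemma dirichlet_bumps_le (p : R) : 1 <= p ->
  exists2 C : R, 0 < C & forall N (lam a w : 'I_N -> R),
    (forall k, 0 <= lam k) -> separated_annuli D a w ->
    (\int[lebesgue_rV D]_x (enorm (grad (@bumps R D N lam a w) x) `^ p)%:E <=
     (C * \sum_k lam k `^ p * (a k ^+ n * w k `^ (1 - p)))%:E)%E.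
Proof.
move=> p1; have p0 : 0 < p by exact: lt_le_trans p1.
have [Cv Cv0 vol] := @annulus_volume_le R n.
have D0 : 0 < D%:R :> R by [].
exists ((16 * D%:R) `^ p * Cv); first by rewrite mulr_gt0// powR_gt0// mulr_gt0.
move=> N lam a w lam0 [w0 wa disj].
apply: (@le_trans _ _ (\int[lebesgue_rV D]_x
    (\sum_k (16 * D%:R * lam k / w k) `^ p * \1_(annulus (a k) (w k)) x)%:E)%E).
  apply: le_integral_ge0 => x; first by rewrite lee_fin powR_ge0.
  by rewrite lee_fin; exact: grad_bumps_powR_le.
rewrite integral_sum_indic; [|by move=> k; exact: powR_ge0|by move=> k; exact: measurable_annulus].
rewrite mulr_sumr -sumEFin; apply: lee_sum => k _.
apply: (@le_trans _ _ (((16 * D%:R * lam k / w k) `^ p)%:E * (Cv * (a k ^+ n * w k))%:E)%E).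
  by apply: lee_wpmul2l; [rewrite lee_fin powR_ge0|exact: vol].
have w0k := ltW (w0 k).
rewrite -EFinM lee_fin le_eqVlt; apply/orP; left; apply/eqP.
rewrite powRM ?invr_ge0// ?mulr_ge0// powRM// ?mulr_ge0//.
rewrite -(powR_inv1 w0k) -powRrM mulN1r.
have wk (x : R) : (x == 0) ==> (w k != 0) by rewrite (gt_eqF (w0 k)) implybT.
by rewrite addrC (powRD (wk _)) powRr1//; ring.
Qed.

Lemma integral_bumps_ge (gamma : R) : 0 < gamma ->
  exists2 c : R, 0 < c & forall N (lam a w : 'I_N -> R),
    (forall k, 0 <= lam k) -> separated_annuli D a w ->
    ((c * \sum_k lam k `^ gamma * (a k ^+ n * w k))%:E <=
     \int[lebesgue_rV D]_x (`|@bumps R D N lam a w x| `^ gamma)%:E)%E.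
Proof.
move=> g0; have [c c0 vol] := @annulus_volume_ge R n.
exists (2^-1 `^ gamma * (c / 2)); first by rewrite mulr_gt0 ?powR_gt0 ?divr_gt0.
move=> N lam a w lam0 [w0 wa disj].
apply: (@le_trans _ _ (\int[lebesgue_rV D]_x
    (\sum_k (lam k / 2) `^ gamma * \1_(annulus (a k) (w k / 2)) x)%:E)%E); last first.
  apply: le_integral_ge0 => x.
    by rewrite lee_fin sumr_ge0// => k _; rewrite mulr_ge0 ?powR_ge0// indicE.
  by rewrite lee_fin; exact: bumps_powR_ge.
rewrite integral_sum_indic; [|by move=> k; exact: powR_ge0|by move=> k; exact: measurable_annulus].
rewrite mulr_sumr -sumEFin; apply: lee_sum => k _.
apply: (@le_trans _ _ (((lam k / 2) `^ gamma)%:E * (c * (a k ^+ n * (w k / 2)))%:E)%E); last first.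
  apply: lee_wpmul2l; first by rewrite lee_fin powR_ge0.
  apply: vol; first by rewrite divr_gt0.
  by have := wa k; have := w0 k; lra.
rewrite -EFinM lee_fin powRM ?invr_ge0// le_eqVlt; apply/orP; left; apply/eqP.
by field.
Qed.

(* The kernel is integrated over the annulus of larger radius, split into the
   pieces on which one coordinate is bounded below; there one integrates first
   in that coordinate, the kernel being dominated by a product kernel in the
   others. *)
Lemma coulomb_bumps_le (alpha q : R) : (0 < n)%N -> 1 < alpha -> alpha < D%:R -> 0 < q ->
  exists2 C : R, 0 < C & forall N (lam a w : 'I_N -> R),
    (forall k, 0 <= lam k) -> separated_annuli D a w ->
    (coulomb_energy alpha q (@bumps R D N lam a w) <=
     (C * \sum_(t : 'I_N * 'I_N)
        (lam t.1 `^ q * (w t.1 * a t.1 ^+ n)) * (lam t.2 `^ q * (w t.2 * a t.2 ^+ n)) *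
        Num.max (a t.1) (a t.2) `^ (alpha - D%:R))%:E)%E.
Proof.
move=> n0 al1 alD q0.
have nR : 0 < n%:R :> R by rewrite ltr0n.
have DE : D%:R = n%:R + 1 :> R by rewrite natr1.
have D0 : 0 < D%:R :> R by [].
have D1 : 1 <= D%:R :> R by rewrite ler1n.
(* Chosen so that (1 - eps)(d - 1) = d - alpha: the kernel is shared equally among d - 1
   coordinates. It is positive because alpha > 1. *)
pose eps := (alpha - 1) / n%:R.
have eps0 : 0 < eps by rewrite divr_gt0// subr_gt0.
have eps1 : eps <= 1 by rewrite ler_pdivrMr// mul1r; lra.
pose b := D%:R - alpha.
have b0 : 0 < b by rewrite subr_gt0.
have bE : b = (1 - eps) * D.-1%:R.
  by rewrite /b /eps DE /=; field; rewrite gt_eqF.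
have [h [c [mh h0 hN hge [c0 hint]]]] := kernel_majorant eps0 eps1.
have [Cv Cv0 vol] := @annulus_volume_le R n.
(* Coordinates in an annulus of radius at most M are at most 2M, so two such points are within 4 d
   M. *)
pose V : R := 4 * D%:R.
have V1 : 1 <= V by rewrite /V; lra.
pose CV := V `^ (2 * eps * D.-1%:R).
have CV0 : 0 < CV by rewrite powR_gt0// (lt_le_trans _ V1).
exists (D%:R * (CV * (8 * D%:R * c ^+ n * Cv)) + 1).
  by rewrite ltr_pwDr// !mulr_ge0 ?exprn_ge0// ltW.
move=> N lam a w lam0 [w0 wa disj].
have a0 k : 0 < a k by rewrite (lt_le_trans _ (wa k))// mulr_gt0.
pose S k : set 'rV[R]_D := annulus (a k) (w k).
pose P i k : set 'rV[R]_D := annulus_piece i (a k) (w k).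
have mS k : measurable (S k) by exact: measurable_annulus.
have mP i k : measurable (P i k) by exact: measurable_annulus_piece.
have PS i k x : P i k x -> S k x by move=> /andP[].
pose M (t : 'I_N * 'I_N) := Num.max (a t.1) (a t.2).
have M0 t : 0 < M t by rewrite /M lt_max a0.
pose L (t : 'I_N * 'I_N) := lam t.1 `^ q * lam t.2 `^ q.
have L0 t : 0 <= L t by rewrite mulr_ge0// powR_ge0.
pose K t := L t * (CV * M t `^ (- b)).
have K0 t : 0 <= K t by rewrite !mulr_ge0 ?powR_ge0// ltW.
(* The annulus of larger radius is the one cut into pieces, and its variable will be integrated
   first; the kernel is scaled by that radius. *)
pose A (u : 'I_N * 'I_N * 'I_D) := if a u.1.1 <= a u.1.2 then S u.1.1 else P u.2 u.1.1.
pose B (u : 'I_N * 'I_N * 'I_D) := if a u.1.1 <= a u.1.2 then P u.2 u.1.2 else S u.1.2.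
have mA u : measurable (A u) by rewrite /A; case: ifP.
have mB u : measurable (B u) by rewrite /B; case: ifP.
pose H (u : 'I_N * 'I_N * 'I_D) (x y : 'rV[R]_D) := prod_kernel h (predC1 u.2) (M u.1) x y.
have H0 u x y : (0 <= H u x y)%E by exact: prode_ge0.
have mH u : measurable_fun setT (fun z : 'rV[R]_D * 'rV[R]_D => H u z.1 z.2).
  exact: measurable_prod_kernel.
pose F u x y : \bar R :=
  ((K u.1)%:E * ((\1_(A u) y)%:E * ((\1_(B u) x)%:E * H u x y)))%E.
have F0 u x y : (0 <= F u x y)%E by rewrite !mule_ge0 ?lee_fin.
have mG u : measurable_fun setT (fun z : 'rV[R]_D * 'rV[R]_D =>
    ((\1_(A u) z.2)%:E * ((\1_(B u) z.1)%:E * H u z.1 z.2))%E).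
  exact: (measurable_indic2 (G := H u)).
have mF u : measurable_fun setT (fun z : 'rV[R]_D * 'rV[R]_D => F u z.1 z.2).
  exact: emeasurable_funM.
apply: (@le_trans _ _ (\int[lebesgue_rV D]_y \int[lebesgue_rV D]_x
   \sum_(u : 'I_N * 'I_N * 'I_D) F u x y)%E).
  apply: le_integral_ge0 => y.
    by apply: integral_ge0 => x _; rewrite lee_fin !mulr_ge0 ?invr_ge0 ?powR_ge0.
  apply: le_integral_ge0 => x; first by rewrite lee_fin !mulr_ge0 ?invr_ge0 ?powR_ge0.
  set rho := enorm (x - y); rewrite -/b.
  have r0 : 0 <= (rho `^ b)^-1 by rewrite invr_ge0 powR_ge0.
  apply: (@le_trans _ _ (\sum_(t : 'I_N * 'I_N)
      (L t * (\1_(S t.1) y * \1_(S t.2) x) * (rho `^ b)^-1)%:E)%E).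
    rewrite sumEFin lee_fin -mulr_suml ler_wpM2r//.
    rewrite mulrC; apply: (le_trans (ler_pM _ _
      (bumps_powR_le lam0 w0 wa disj y q0) (bumps_powR_le lam0 w0 wa disj x q0)));
      rewrite ?powR_ge0//.
    rewrite big_distrlr/= pair_bigA/= le_eqVlt; apply/orP; left; apply/eqP.
    by apply: eq_bigr => t _; rewrite /L -/(S _) -/(S _); ring.
  rewrite -(pair_bigA _ (fun t i => F (t, i) x y))/=.
  apply: lee_sum => t _.
  have Fs i : (F (t, i) x y <= \sum_j F (t, j) x y)%E.
    by rewrite (bigD1 i)//= leeDl//; apply: sume_ge0 => j _; exact: F0.
  have [yS|yS] := pselect (S t.1 y); last first.
    rewrite (_ : L t * _ * _ = 0); last by rewrite (indicE _ (S t.1)) memNset// mul0r mulr0 mul0r.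
    by apply: sume_ge0 => j _; exact: F0.
  have [xS|xS] := pselect (S t.2 x); last first.
    rewrite (_ : L t * _ * _ = 0); last by rewrite (indicE _ (S t.2)) memNset// !mulr0 mul0r.
    by apply: sume_ge0 => j _; exact: F0.
  rewrite !indicE !mem_set// !mulr1.
  have rhoV : rho <= V * M t.
    rewrite (_ : V * M t = D%:R * (4 * M t)); last by rewrite /V; ring.
    apply: enorm_le => [|i]; first by rewrite mulr_ge0// ltW.
    rewrite !mxE; apply: (le_trans (ler_normB _ _)).
    have := annulus_coord i (a0 t.2) (wa t.2) xS; have := annulus_coord i (a0 t.1) (wa t.1) yS.
    have : a t.1 <= M t by rewrite le_max lexx.
    have : a t.2 <= M t by rewrite le_max lexx orbT.
    lra.
  have [i [Ai Bi]] : exists i, A (t, i) y /\ B (t, i) x.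
    rewrite /A /B/=; case: (a t.1 <= a t.2).
      by have [i iP] := annulus_cover (a0 t.2) (wa t.2) xS; exists i.
    by have [i iP] := annulus_cover (a0 t.1) (wa t.1) yS; exists i.
  apply: le_trans (Fs i).
  rewrite /F !indicE !mem_set// !mul1e /K/=.
  rewrite (EFinM (L t) (rho `^ b)^-1) (EFinM (L t) (CV * M t `^ (- b))) -muleA.
  apply: lee_wpmul2l; first by rewrite lee_fin.
  exact: (coulomb_kernel_le h0 hge eps0 i b0 bE V1 (M0 t) rhoV).
rewrite (@integral2_sum _ _ _ (lebesgue_rV D) _ _ F)//.
pose W (t : 'I_N * 'I_N) := w t.1 * a t.1 ^+ n * (w t.2 * a t.2 ^+ n).
have W0 t : 0 <= W t by rewrite !mulr_ge0 ?exprn_ge0// ltW.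
apply: (@le_trans _ _ (\sum_(u : 'I_N * 'I_N * 'I_D)
    (K u.1 * (8 * D%:R * c ^+ n * Cv * W u.1))%:E)%E).
  apply: lee_sum => u _.
  rewrite (@integral2Zl _ _ _ (lebesgue_rV D))//; last first.
    by move=> x y; rewrite !mule_ge0 ?lee_fin.
  rewrite [leRHS]EFinM; apply: lee_wpmul2l; first by rewrite lee_fin.
  have B0 j k : (0 <= (8 * D%:R * w j * (c * a k) ^+ D.-1)%:E)%E.
    by rewrite lee_fin !mulr_ge0 ?exprn_ge0 ?mulr_ge0// ltW.
  rewrite /A /B; case: ifPn => [le12|]; last rewrite -ltNge => /ltW le21.
    have ME : M u.1 = a u.1.2 by rewrite /M max_r.
    apply: le_trans (integral2_le_inner (B := (8 * D%:R * w u.1.2 * (c * a u.1.2) ^+ D.-1)%:E)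
      (mH u) _ _ _ _ _) _ => //.
      move=> y; rewrite /H ME.
      exact: integral_piece_kernel_le.
    apply: (le_trans (lee_wpmul2l _ (vol _ _ (w0 u.1.1) (wa u.1.1)))) => //.
    rewrite -EFinM lee_fin le_eqVlt; apply/orP; left; apply/eqP.
    by rewrite /W /= exprMn; ring.
  have ME : M u.1 = a u.1.1 by rewrite /M max_l.
  apply: le_trans (integral2_le_outer (B := (8 * D%:R * w u.1.1 * (c * a u.1.1) ^+ D.-1)%:E)
      (mH u) _ _ _ _ _) _ => //.
    move=> x; under eq_integral do rewrite /H ME prod_kernelC//.
    exact: integral_piece_kernel_le.
  apply: (le_trans (lee_wpmul2l _ (vol _ _ (w0 u.1.2) (wa u.1.2)))) => //.
  rewrite -EFinM lee_fin le_eqVlt; apply/orP; left; apply/eqP.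
  by rewrite /W /= exprMn; ring.
rewrite sumEFin lee_fin.
rewrite -(pair_bigA _ (fun t (i : 'I_D) => K t * (8 * D%:R * c ^+ n * Cv * W t)))/=.
rewrite [leRHS]mulrDl mul1r.
apply: (@le_trans _ _ (D%:R * (CV * (8 * D%:R * c ^+ n * Cv)) * \sum_(t : 'I_N * 'I_N)
    (lam t.1 `^ q * (w t.1 * a t.1 ^+ n)) * (lam t.2 `^ q * (w t.2 * a t.2 ^+ n)) *
        Num.max (a t.1) (a t.2) `^ (alpha - D%:R))); last first.
  rewrite lerDl sumr_ge0// => t _.
  have wn k : 0 <= w k * a k ^+ n by rewrite mulr_ge0 ?exprn_ge0// ltW.
  apply: mulr_ge0; last exact: powR_ge0.
  by apply: mulr_ge0; apply: mulr_ge0 => //; exact: powR_ge0.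
rewrite mulr_sumr le_eqVlt; apply/orP; left; apply/eqP; apply: eq_bigr => t _.
rewrite sumr_const card_ord -[LHS]mulr_natl /K /L /W /M -/b.
rewrite (_ : - b = alpha - D%:R); last by rewrite /b opprB.
by ring.
Qed.

End energies_local.

(** * Conclusion *)

Section contradiction.
Context {R : realType}.

Lemma lee_poweR (x y : \bar R) (r : R) : 0 <= r -> (0 <= x)%E -> (x <= y)%E ->
  (x `^ r <= y `^ r)%E.
Proof.
move=> r0 x0 xy; apply: (gt0_ler_poweR r0) => //; rewrite in_itv/= leey andbT//.
exact: le_trans xy.
Qed.

(** One base serves all exponents above [e], so several largeness conditions can be met together. *)
Lemma powR_unbounded (e : R) : 0 < e -> forall M, exists2 t : R, 1 < t &
  forall e', e <= e' -> M <= t `^ e'.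
Proof.
move=> e0 M; pose t := (Num.max 1 M + 1) `^ e^-1.
have m1 : 1 < Num.max 1 M + 1 by rewrite ltr_pwDr// le_max lexx.
have t1 : 1 < t.
  rewrite -[ltLHS](powRr0 (Num.max 1 M + 1)) /t.
  have i0 : 0 < e^-1 by rewrite invr_gt0.
  have : 1 `^ e^-1 < (Num.max 1 M + 1) `^ e^-1.
    by apply: (gt0_ltr_powR i0) => //; rewrite nnegrE ?(ltW (lt_trans ltr01 m1)).
  by rewrite powR1 powRr0.
exists t => // e' ee'; apply: (@le_trans _ _ (t `^ e)); last by apply: ler_powR => //; exact: ltW.
rewrite -powRrM mulVf ?gt_eqF// powRr1; last exact: ltW (lt_trans ltr01 m1).
by rewrite (@le_trans _ _ (Num.max 1 M)) ?le_max ?lexx ?orbT// lerDl.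
Qed.

(** The next three sums stand, up to constants, for the integral of |g|^gamma (from below), the p-th
    power of the seminorm and the Coulomb energy (both from above). *)
Definition annuli_mass N n (gamma : R) (lam a w : 'I_N -> R) : R :=
  \sum_k lam k `^ gamma * (a k ^+ n * w k).

Definition annuli_sobolev N n (s p : R) (lam a w : 'I_N -> R) : R :=
  \sum_k lam k `^ p * (a k ^+ n * w k `^ (1 - s * p)).

Definition annuli_coulomb N n (alpha q : R) (lam a w : 'I_N -> R) : R :=
  \sum_(t : 'I_N * 'I_N)
    (lam t.1 `^ q * (w t.1 * a t.1 ^+ n)) * (lam t.2 `^ q * (w t.2 * a t.2 ^+ n)) *
    Num.max (a t.1) (a t.2) `^ (alpha - n.+1%:R).

Lemma annuli_inequality (n : nat) (s gamma p q alpha beta1 beta2 C : R) :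
  (0 < n)%N -> 0 < s -> s <= 1 -> 1 < gamma -> 1 <= p -> 1 <= q ->
  1 < alpha -> alpha < n.+1%:R -> 0 < beta1 -> 0 < beta2 -> 0 < C ->
  (forall g : 'rV[R]_n.+1 -> R, C1c_rad g ->
        ('N[lebesgue_rV n.+1]_(gamma%:E) [EFin \o g] <=
         C%:E * sobolev_seminorm s p g `^ (beta1 * p) *
           coulomb_energy alpha q g `^ beta2)%E) ->
  exists2 K : R, 0 < K & forall N (lam a w : 'I_N -> R),
    (forall k, 0 <= lam k) -> separated_annuli n.+1 a w ->
    annuli_mass n gamma lam a w <=
    K * annuli_sobolev n s p lam a w `^ (beta1 * gamma) *
        annuli_coulomb n alpha q lam a w `^ (beta2 * gamma).
Proof.
move=> n0 s0 s1 g1 p1 q1 al1 alD b10 b20 C0 HC.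
have p0 : 0 < p by exact: lt_le_trans p1.
have q0 : 0 < q by exact: lt_le_trans q1.
have g0 : 0 < gamma by exact: lt_trans g1.
have [K1 K10 lower] := @integral_bumps_ge R n gamma g0.
have [K3 K30 coul] := @coulomb_bumps_le R n alpha q n0 al1 alD q0.
have [K2 K20 sob] : exists2 K2 : R, 0 < K2 & forall N (lam a w : 'I_N -> R),
    (forall k, 0 <= lam k) -> separated_annuli n.+1 a w ->
    (sobolev_seminorm s p (@bumps R n.+1 N lam a w) <=
     ((K2 * annuli_sobolev n s p lam a w)%:E `^ p^-1))%E.
  have pi0 : 0 <= p^-1 by rewrite invr_ge0 ltW.
  rewrite /sobolev_seminorm; case: eqP => [->|/eqP sn1].
    have [K2 K20 H] := @dirichlet_bumps_le R n p p1.
    exists K2 => // N lam a w lam0 sep; apply: lee_poweR => //.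
      by apply: integral_ge0 => x _; rewrite lee_fin powR_ge0.
    by rewrite /annuli_sobolev mul1r; exact: H.
  have s1' : s < 1 by rewrite lt_neqAle sn1.
  have [K2 K20 H] := @gagliardo_bumps_le R n s p s0 s1' p1.
  exists K2 => // N lam a w lam0 sep; apply: lee_poweR => //.
    apply: integral_ge0 => y _; apply: integral_ge0 => x _.
    by rewrite lee_fin divr_ge0 ?powR_ge0.
  exact: H.
exists (K1^-1 * (C `^ gamma * K2 `^ (beta1 * gamma) * K3 `^ (beta2 * gamma))).
  by rewrite mulr_gt0 ?invr_gt0// !mulr_gt0// powR_gt0.
move=> N lam a w lam0 sep.
have [w0 wa _] := sep.
have a0 k : 0 <= a k by rewrite (le_trans _ (wa k))// mulr_ge0// ltW.
set X := annuli_mass _ _ _ _ _; set Y := annuli_sobolev _ _ _ _ _ _.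
set Z := annuli_coulomb _ _ _ _ _ _.
have wn k : 0 <= w k * a k ^+ n by rewrite mulr_ge0 ?exprn_ge0// ltW.
have X0 : 0 <= X.
  apply: sumr_ge0 => k _; apply: mulr_ge0; first exact: powR_ge0.
  by rewrite mulrC.
have Y0 : 0 <= Y.
  apply: sumr_ge0 => k _; apply: mulr_ge0; first exact: powR_ge0.
  by rewrite mulr_ge0 ?exprn_ge0 ?powR_ge0.
have Z0 : 0 <= Z.
  apply: sumr_ge0 => t _; apply: mulr_ge0; last exact: powR_ge0.
  by apply: mulr_ge0; apply: mulr_ge0 => //; exact: powR_ge0.
have := HC _ (@C1c_rad_bumps R n.+1 N lam a w w0 wa).
rewrite unlock /Lnorm.
set Nm := (X in (X <= _ -> _)%E) => HN.
have L1 : (((K1 * X) `^ gamma^-1)%:E <= Nm)%E.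
  rewrite -poweR_EFin /Nm; apply: lee_poweR; first by rewrite invr_ge0 ltW.
    by rewrite lee_fin mulr_ge0// ltW.
  exact: lower.
have L2 : (sobolev_seminorm s p (@bumps R n.+1 N lam a w) `^ (beta1 * p) <=
    ((K2 * Y) `^ beta1)%:E)%E.
  apply: (@le_trans _ _ (((K2 * Y)%:E `^ p^-1) `^ (beta1 * p))%E).
    apply: lee_poweR; first by rewrite mulr_ge0// ltW.
      by rewrite /sobolev_seminorm; case: ifP => _; exact: poweR_ge0.
    exact: sob.
  by rewrite !poweR_EFin -powRrM mulrCA mulVf ?gt_eqF// mulr1.
have L3 : (coulomb_energy alpha q (@bumps R n.+1 N lam a w) `^ beta2 <=
    ((K3 * Z) `^ beta2)%:E)%E.
  rewrite -poweR_EFin; apply: lee_poweR; first exact: ltW.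
    apply: integral_ge0 => y _; apply: integral_ge0 => x _.
    by rewrite lee_fin !mulr_ge0 ?invr_ge0 ?powR_ge0.
  exact: coul.
have : (K1 * X) `^ gamma^-1 <= C * (K2 * Y) `^ beta1 * (K3 * Z) `^ beta2.
  rewrite -lee_fin; apply: (le_trans L1); apply: (le_trans HN).
  rewrite [leRHS]EFinM; apply: lee_pmul => //; [|exact: poweR_ge0|].
    by rewrite mule_ge0 ?poweR_ge0// lee_fin ltW.
  by rewrite EFinM; apply: lee_wpmul2l => //; rewrite lee_fin ltW.
have KX : 0 <= K1 * X by rewrite mulr_ge0// ltW.
move=> /(fun h => powR_le_base (powR_ge0 _ _) h (ltW g0)).
rewrite -powRrM mulVf ?gt_eqF// powRr1//.
rewrite powRM ?powR_ge0//; last by rewrite mulr_ge0 ?powR_ge0// ltW.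
rewrite powRM ?powR_ge0//; last exact: ltW.
rewrite -!powRrM (powRM _ (ltW K20) Y0) (powRM _ (ltW K30) Z0) => H.
rewrite -ler_pdivlMl// in H; apply: (le_trans H).
by rewrite le_eqVlt; apply/orP; left; apply/eqP; ring.
Qed.

Lemma subcritical_contradiction (n : nat) (s gamma p q alpha beta1 beta2 K : R) :
  (0 < n)%N ->
  beta1 * gamma + (n.+1%:R + alpha - 2) / (n.+1%:R - 1) * beta2 * gamma < 1 ->
  ~ (forall N (lam a w : 'I_N -> R),
    (forall k, 0 <= lam k) -> separated_annuli n.+1 a w ->
    annuli_mass n gamma lam a w <=
    K * annuli_sobolev n s p lam a w `^ (beta1 * gamma) *
        annuli_coulomb n alpha q lam a w `^ (beta2 * gamma)).
Proof.
move=> n0 sub H.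
have nR : 0 < n%:R :> R by rewrite ltr0n.
have DE : n.+1%:R = n%:R + 1 :> R by rewrite natr1.
(* The exponent of the radius on the left minus that on the right; the subcritical condition
   multiplied by d - 1 says that it is positive. *)
pose e := n%:R - n%:R * (beta1 * gamma) - (n%:R + alpha - 1) * (beta2 * gamma).
have e0 : 0 < e.
  have := sub; rewrite DE addrK -(ltr_pM2l nR) mulr1 => h.
  rewrite /e subr_gt0 ltrBrDr; apply: le_lt_trans h.
  by rewrite le_eqVlt; apply/orP; left; apply/eqP; field; rewrite gt_eqF.
have [t0 t01 t0P] := powR_unbounded e0 (K + 1).
(* The factor 4 ensures 4 w <= a for w = 1. *)
pose t := 4 * t0.
have t1 : 0 < t by rewrite /t; lra.
have t4 : 4 * 1 <= t by rewrite /t; lra.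
have tK : K + 1 <= t `^ e.
  apply: (le_trans (t0P e _)) => //; apply: powR_le_base; [lra|rewrite /t; lra|exact: ltW].
have := H 1 (fun=> 1) (fun=> t) (fun=> 1) (fun=> ler01).
have sep : separated_annuli n.+1 (fun=> t) (fun _ : 'I_1 => 1 : R).
  by split => // x j k _ _; rewrite (ord1 j) (ord1 k).
move=> /(_ sep).
rewrite /annuli_mass /annuli_sobolev /annuli_coulomb.
rewrite -(pair_bigA _ (fun j k : 'I_1 => 1 `^ q * (1 * t ^+ n) * (1 `^ q * (1 * t ^+ n)) *
  Num.max t t `^ (alpha - n.+1%:R)))/= !big_ord_recl !big_ord0 !addr0.
rewrite maxxx !powR1 !mul1r !mulr1 -powR_mulrn ?(ltW t1)//.
have tk (x : R) : (x == 0) ==> (t != 0) by rewrite (gt_eqF t1) implybT.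
rewrite -!(powRD (tk _)) -!powRrM -mulrA -(powRD (tk _)) => Hn.
set e2 := _ + _ in Hn.
have E : n%:R = e + e2 by rewrite /e /e2 DE; ring.
move: Hn; rewrite {1}E (powRD (tk _)) ler_pM2r ?powR_gt0// => Hn.
by have := le_trans tK Hn; rewrite gerDl ler10.
Qed.

End contradiction.

(** * The critical case: annuli at geometric scales *)

Section critical.
Context {R : realType}.

(* Annuli of radius T ^ (rho k), width T ^ (tau k) and height T ^ (l k); the
   linear relations make each of them contribute 1 to the three functionals. *)
Lemma critical_annuli (n N : nat) (s gamma p q alpha l rho tau : R) :
  (0 < N)%N -> alpha < n.+1%:R ->
  p * l + n%:R * rho + (1 - s * p) * tau = 0 ->
  2 * q * l + (n%:R + alpha - 1) * rho + 2 * tau = 0 ->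
  gamma * l + n%:R * rho + tau = 0 ->
  tau < rho -> rho != 0 ->
  exists lam a w : 'I_N -> R, [/\ forall k, 0 <= lam k, separated_annuli n.+1 a w,
    annuli_mass n gamma lam a w = N%:R, annuli_sobolev n s p lam a w = N%:R &
    annuli_coulomb n alpha q lam a w <= 2 * N%:R].
Proof.
move=> N0 alD Hp Hq Hg tr r0.
have NR : 0 < N%:R :> R by rewrite ltr0n.
pose b := n.+1%:R - alpha.
have b0 : 0 < b by rewrite subr_gt0.
have ar0 : 0 < `|rho| by rewrite normr_gt0.
(* The three entries serve in turn the thinness 4 w <= a, the ratio 4 between distinct radii, and
   interactions of size at most 1 / N. *)
pose e := Num.min (rho - tau) (Num.min `|rho| (b / 2 * `|rho|)).
have e0 : 0 < e by rewrite !lt_min subr_gt0 tr ar0 mulr_gt0// divr_gt0.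
have [T T1 TP] := powR_unbounded e0 (Num.max 4 N%:R).
have T0 : 0 < T by exact: lt_trans T1.
have TX (x : R) : 0 < T `^ x by exact: powR_gt0.
have TD (x y : R) : T `^ (x + y) = T `^ x * T `^ y.
  by rewrite powRD// (gt_eqF T0) implybT.
have T4 e' : e <= e' -> 4 <= T `^ e'.
  by move=> /TP; apply: le_trans; rewrite le_max lexx.
have TN e' : e <= e' -> N%:R <= T `^ e'.
  by move=> /TP; apply: le_trans; rewrite le_max lexx orbT.
(* Exponents start at 1: exponent 0 would give w = a = 1. *)
pose kk (k : 'I_N) : R := k.+1%:R.
have kk1 k : 1 <= kk k by rewrite ler1n.
pose lam k := T `^ (l * kk k).
pose a k := T `^ (rho * kk k).
pose w k := T `^ (tau * kk k).
have TXn (x : R) m : (T `^ x) ^+ m = T `^ (x * m%:R).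
  by rewrite powRrM powR_mulrn// powR_ge0.
have wa k : 4 * w k <= a k.
  rewrite /a /w (_ : rho * kk k = (rho - tau) * kk k + tau * kk k); last by ring.
  rewrite TD ler_wpM2r ?powR_ge0//; apply: T4.
  apply: (@le_trans _ _ (rho - tau)); first by rewrite ge_min lexx.
  by rewrite ler_peMr// subr_ge0 ltW.
(* The sign of [rho] is not fixed, so the radii may decrease with the index. *)
have gap (j k : 'I_N) : j != k ->
    `|rho| + rho * kk j <= rho * kk k \/ `|rho| + rho * kk k <= rho * kk j.
  move=> jk.
  have S (i m : 'I_N) : (i < m)%N -> kk i + 1 <= kk m.
    by move=> im; rewrite /kk natr1 ler_nat.
  have [rp|rn] := leP 0 rho.
    rewrite ger0_norm//; case: (ltngtP j k) => [/S h|/S h|/val_inj jk'].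
    - left; nra.
    - right; nra.
    - by rewrite jk' eqxx in jk.
  rewrite ltr0_norm//; case: (ltngtP j k) => [/S h|/S h|/val_inj jk'].
  - right; nra.
  - left; nra.
  - by rewrite jk' eqxx in jk.
have far j k : `|rho| + rho * kk j <= rho * kk k -> 4 * a j <= a k.
  move=> h; apply: (@le_trans _ _ (T `^ (`|rho| + rho * kk j))).
    rewrite TD ler_wpM2r ?powR_ge0//; apply: T4.
    by rewrite !ge_min lexx orbT.
  by apply: ler_powR => //; exact: ltW.
(* A common point would satisfy |x|^2 <= 5/4 a_j^2 and |x|^2 >= 3/4 a_k^2 >= 12 a_j^2. *)
have apart (x : 'rV[R]_n.+1) j k : 4 * a j <= a k ->
    annulus (a j) (w j) x -> annulus (a k) (w k) x -> False.
  rewrite /annulus/= => h; rewrite !ler_distl => /andP[_ h1] /andP[h2 _].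
  have aj0 : 0 < a j by exact: TX.
  have := wa j; have := wa k; nra.
have sep : separated_annuli n.+1 a w.
  split=> [k|k|x j k xj xk]; [exact: TX|exact: wa|].
  apply/eqP/negPn/negP => /gap[/far h|/far h]; first exact: apart xj xk.
  exact: apart xk xj.
exists lam, a, w; split => //.
- by move=> k; exact: powR_ge0.
- rewrite /annuli_mass (eq_bigr (fun=> 1)) => [|k _]; first by rewrite sumr_const card_ord.
  rewrite /lam /a /w -powRrM TXn -!TD.
  rewrite (_ : _ + _ = (gamma * l + n%:R * rho + tau) * kk k); last by ring.
  by rewrite Hg mul0r powRr0.
- rewrite /annuli_sobolev (eq_bigr (fun=> 1)) => [|k _]; first by rewrite sumr_const card_ord.
  rewrite /lam /a /w -!powRrM TXn -!TD.
  rewrite (_ : _ + _ = (p * l + n%:R * rho + (1 - s * p) * tau) * kk k); last by ring.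
  by rewrite Hp mul0r powRr0.
rewrite /annuli_coulomb.
(* The weight is a_k^(b/2), half the kernel exponent: two weights times the larger radius to the
   power -b equal the ratio of the smaller radius to the larger one to the power b/2. *)
have fE k : lam k `^ q * (w k * a k ^+ n) = T `^ (b / 2 * (rho * kk k)).
  rewrite /lam /a /w -!powRrM TXn -!TD; congr (T `^ _).
  have -> : b / 2 * (rho * kk k) = (b / 2 * (rho * kk k)) + kk k / 2 *
      (2 * q * l + (n%:R + alpha - 1) * rho + 2 * tau) by rewrite Hq mulr0 addr0.
  by rewrite /b -(@natr1 _ n); field.
have off j k : `|rho| + rho * kk j <= rho * kk k ->
    T `^ (b / 2 * (rho * kk j)) * T `^ (b / 2 * (rho * kk k)) * a k `^ (alpha - n.+1%:R) <= N%:R^-1.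
  move=> h; rewrite /a -powRrM -!TD.
  rewrite (_ : _ + _ = - (b / 2 * (rho * kk k - rho * kk j))); last by rewrite /b; field.
  rewrite powRN lef_pV2 ?posrE//; apply: TN.
  apply: (@le_trans _ _ (b / 2 * `|rho|)); first by rewrite !ge_min lexx !orbT.
  by rewrite ler_wpM2l ?divr_ge0 ?(ltW b0)//; lra.
(* The diagonal adds up to N, and N^2 terms 1 / N add up to another N. *)
apply: (@le_trans _ _ (\sum_(t : 'I_N * 'I_N) ((t.1 == t.2)%:R + N%:R^-1))).
  apply: ler_sum => -[j k] _ /=; rewrite !fE.
  have [->|jk] := eqVneq j k.
    rewrite maxxx /a -powRrM -!TD [X in T `^ X](_ : _ = 0); last by rewrite /b; field.
    by rewrite powRr0 lerDl invr_ge0 ltW.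
  rewrite add0r; case: (gap _ _ jk) => h.
    rewrite max_r; first exact: off.
    by apply: le_trans (far _ _ h); rewrite ler_peMl ?powR_ge0// ler1n.
  rewrite max_l; first by rewrite [X in X * _]mulrC; exact: off.
  by apply: le_trans (far _ _ h); rewrite ler_peMl ?powR_ge0// ler1n.
rewrite -(pair_bigA _ (fun j k : 'I_N => (j == k)%:R + N%:R^-1))/=.
rewrite (eq_bigr (fun=> 2)) => [|j _]; first by rewrite sumr_const card_ord mulr_natr.
rewrite big_split/= sumr_const card_ord -[_ *+ _]mulr_natr mulVf ?gt_eqF//.
rewrite (bigD1 j)//= eqxx big1 ?addr0// => k kj.
by rewrite eq_sym (negPf kj).
Qed.

Lemma critical_contradiction (n : nat) (s gamma p q alpha beta1 beta2 K : R) :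
  (0 < n)%N -> 0 < gamma -> 1 < alpha -> alpha < n.+1%:R -> 0 < beta2 -> 0 < K ->
  beta1 * p + 2 * beta2 * q = 1 ->
  (n.+1%:R - s * p) * beta1 + (n.+1%:R + alpha) * beta2 = n.+1%:R / gamma ->
  p * (n.+1%:R + alpha) - 2 * q * (n.+1%:R - s * p) != 0 ->
  beta1 * gamma + (n.+1%:R + alpha - 2) / (n.+1%:R - 1) * beta2 * gamma = 1 ->
  q * (1 - s * p) != p ->
  ~ (forall N (lam a w : 'I_N -> R),
    (forall k, 0 <= lam k) -> separated_annuli n.+1 a w ->
    annuli_mass n gamma lam a w <=
    K * annuli_sobolev n s p lam a w `^ (beta1 * gamma) *
        annuli_coulomb n alpha q lam a w `^ (beta2 * gamma)).
Proof.
move=> n0 g0 al1 alD b20 K0 eq1 eq2 ne1 crit ne2 H.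
have nR : 0 < n%:R :> R by rewrite ltr0n.
have DE : n.+1%:R = n%:R + 1 :> R by rewrite natr1.
have C1 : n%:R * (beta1 * gamma) + (n%:R + alpha - 1) * (beta2 * gamma) = n%:R.
  have := congr1 (fun z => n%:R * z) crit; rewrite DE mulr1 => E; rewrite -[RHS]E; field.
  by rewrite addrK gt_eqF.
(* The second scaling identity times gamma, minus [C1]. *)
have C2 : (1 - s * p) * (beta1 * gamma) + 2 * (beta2 * gamma) = 1.
  have : ((n.+1%:R - s * p) * beta1 + (n.+1%:R + alpha) * beta2) * gamma = n.+1%:R.
    by rewrite eq2 mulfVK// gt_eqF.
  rewrite DE => h; lra.
(* The cross product of (p, n, 1 - sp) and (2q, n + alpha - 1, 2), hence a solution of the first two
   linear relations. *)
pose l0 := 2 * n%:R - (1 - s * p) * (n%:R + alpha - 1).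
pose rho0 := 2 * q * (1 - s * p) - 2 * p.
pose tau0 := p * (n%:R + alpha - 1) - 2 * q * n%:R.
have rho0n : rho0 != 0.
  rewrite /rho0 -mulrA -mulrBr mulf_neq0// subr_eq0//.
have tr0 : tau0 != rho0.
  rewrite -subr_eq0; suff -> : tau0 - rho0 =
    p * (n.+1%:R + alpha) - 2 * q * (n.+1%:R - s * p) by [].
  by rewrite /tau0 /rho0 DE; ring.
(* The relations are homogeneous, so a change of sign is free; it is used to obtain tau < rho, hence
   thin annuli. *)
have [sg [sg0 sgl]] : exists sg : R, sg != 0 /\ sg * tau0 < sg * rho0.
  move: tr0; rewrite neq_lt => /orP[h|h].
    by exists 1; rewrite oner_eq0 !mul1r.
  by exists (-1); rewrite oppr_eq0 oner_eq0 !mulN1r ltrN2.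
have Hp : p * (sg * l0) + n%:R * (sg * rho0) + (1 - s * p) * (sg * tau0) = 0.
  by rewrite /l0 /rho0 /tau0; ring.
have Hq : 2 * q * (sg * l0) + (n%:R + alpha - 1) * (sg * rho0) + 2 * (sg * tau0) = 0.
  by rewrite /l0 /rho0 /tau0; ring.
(* The assumption [eq1] times gamma, [C1] and [C2] are the three columns of one identity: the vector
   (gamma, n, 1) is beta1 gamma times the Sobolev vector plus beta2 gamma times the Coulomb
   vector. *)
have Hg : gamma * (sg * l0) + n%:R * (sg * rho0) + sg * tau0 = 0.
  set L := sg * l0 in Hp Hq *; set r := sg * rho0 in Hp Hq *; set t := sg * tau0 in Hp Hq *.
  have -> : gamma * L + n%:R * r + t =
      (beta1 * p + 2 * beta2 * q) * gamma * L +
      (n%:R * (beta1 * gamma) + (n%:R + alpha - 1) * (beta2 * gamma)) * r +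
      ((1 - s * p) * (beta1 * gamma) + 2 * (beta2 * gamma)) * t.
    by rewrite eq1 C1 C2; ring.
  rewrite (_ : _ + _ = beta1 * gamma * (p * L + n%:R * r + (1 - s * p) * t) +
    beta2 * gamma * (2 * q * L + (n%:R + alpha - 1) * r + 2 * t)); last by ring.
  by rewrite Hp Hq !mulr0 addr0.
have rn : sg * rho0 != 0 by rewrite mulf_neq0.
pose b1 := beta1 * gamma; pose b2 := beta2 * gamma.
have b2g : 0 < b2 by rewrite mulr_gt0.
(* Positive because [C1] reads n (b1 + b2) + (alpha - 1) b2 = n and alpha > 1. *)
pose th := 1 - (b1 + b2).
have th0 : 0 < th.
  rewrite -(pmulr_rgt0 _ nR) (_ : n%:R * th = (alpha - 1) * b2).
    by rewrite mulr_gt0// subr_gt0.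
  rewrite /th mulrBr mulr1 -{1}C1 -/b1 -/b2; ring.
(* The inequality for N annuli becomes N^th <= K 2^b2, which this threshold contradicts. *)
have [t0 t01 t0P] := powR_unbounded th0 (K * 2 `^ b2 + 1).
have t00 : 0 <= t0 by exact: ltW (lt_trans ltr01 t01).
pose N := Num.bound t0.
have tN : t0 < N%:R by exact: archi_boundP.
have NR : 0 < N%:R :> R by exact: le_lt_trans tN.
have N0 : (0 < N)%N by rewrite -(ltr0n R).
have [lam [a [w [lam0 sep X1 Y1 Z1]]]] :=
  critical_annuli (gamma := gamma) N0 alD Hp Hq Hg sgl rn.
have := H N lam a w lam0 sep; rewrite X1 Y1 -/b1 -/b2 => HN.
have Z0 : 0 <= annuli_coulomb n alpha q lam a w.
  apply: sumr_ge0 => t _; apply: mulr_ge0; last exact: powR_ge0.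
  have [w0 wa _] := sep.
  have wn k : 0 <= w k * a k ^+ n.
    by rewrite mulr_ge0 ?exprn_ge0 ?(ltW (w0 k))// (le_trans _ (wa k))// mulr_ge0// ltW.
  by apply: mulr_ge0; apply: mulr_ge0 => //; exact: powR_ge0.
have HN2 : N%:R <= K * 2 `^ b2 * N%:R `^ (b1 + b2).
  apply: (le_trans HN).
  rewrite powRD; last by rewrite (gt_eqF NR) implybT.
  rewrite [leRHS](_ : _ = K * N%:R `^ b1 * (2 `^ b2 * N%:R `^ b2)); last by ring.
  rewrite -powRM ?(ltW NR)// ler_wpM2l//; first by rewrite mulr_ge0 ?powR_ge0// ltW.
  by apply: powR_le_base => //; exact: ltW.
have NE : N%:R = N%:R `^ th * N%:R `^ (b1 + b2) :> R.
  rewrite -powRD; last by rewrite (gt_eqF NR) implybT.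
  by rewrite /th subrK powRr1// ltW.
move: HN2; rewrite {1}NE ler_pM2r ?powR_gt0// => HN3.
have h1 := t0P th (lexx _).
have h2 := powR_le_base t00 (ltW tN) (ltW th0).
have := le_trans h1 (le_trans h2 HN3).
by rewrite gerDl ler10.
Qed.

End critical.

Unset Implicit Arguments.

Theorem theorem1p4 (R : realType) (d : nat)
    (s gamma p q alpha beta1 beta2 : R) :
  (2 <= d)%N ->
  0 < s -> s <= 1 -> 1 < gamma -> 1 <= p -> 1 <= q ->
  1 < alpha -> alpha < d%:R -> 0 < beta1 -> 0 < beta2 ->
  beta1 * p + 2 * beta2 * q = 1 ->
  (d%:R - s * p) * beta1 + (d%:R + alpha) * beta2 = d%:R / gamma ->
  p * (d%:R + alpha) - 2 * q * (d%:R - s * p) != 0 ->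
  (beta1 * gamma + (d%:R + alpha - 2) / (d%:R - 1) * beta2 * gamma < 1 \/
   (beta1 * gamma + (d%:R + alpha - 2) / (d%:R - 1) * beta2 * gamma = 1 /\
    q * (1 - s * p) != p)) ->
  ~ exists C : R, 0 < C /\
      forall g : 'rV[R]_d -> R, C1c_rad g ->
        ('N[lebesgue_rV d]_(gamma%:E) [EFin \o g] <=
         C%:E * sobolev_seminorm s p g `^ (beta1 * p) *
           coulomb_energy alpha q g `^ beta2)%E.
Proof.
case: d => [//|n]; rewrite ltnS => n0 s0 s1 g1 p1 q1 al1 alD b10 b20 eq1 eq2 ne1 cond [C [C0 HC]].
have [K K0 HK] := annuli_inequality n0 s0 s1 g1 p1 q1 al1 alD b10 b20 C0 HC.
case: cond => [sub|[crit ne2]].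
  exact: (subcritical_contradiction n0 sub HK).
exact: (critical_contradiction n0 (lt_trans ltr01 g1) al1 alD b20 K0 eq1 eq2 ne1 crit ne2 HK).
Qed.
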